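(* Let $\mathfrak g=\mathfrak g_{-1}\oplus\mathfrak g_0\oplus\mathfrak g_1$ be a quasi-reductive Lie superalgebra of type I over $\mathbb C$ with even Cartan subalgebra $\mathfrak h$, let $\mathfrak h'$ be the center of $\mathfrak g_0$, let $L$ be a $\mathfrak g_0$-module, $n\ge 1$ and $\nu\in(\mathfrak h')^*$. Let $H=\mathfrak g_{-1}\oplus\mathfrak h'\oplus\mathfrak g_1$ with the bracket $[-,-]_n$, let $V=L\otimes J_n(\nu)\otimes\Lambda\mathfrak g_{-1}$, and let $\rho_t:\mathfrak g\to\mathrm{End}(V)$ ($t\in\mathbb R$) be the representation corresponding to $K(L;n;t\nu)$, with derivative $\rho'_t$ in $t$. Define a linear map $\phi:H\to\mathfrak{gl}(V)$ by $$\phi(a_-):=\rho_0(a_-),\qquad \phi(a_+):=\rho'_t(a_+),\qquad \phi(h):=\rho'_t(h)$$ for $a_\pm\in\mathfrak g_{\pm1}$ and $h\in\mathfrak h'$. Then $\phi$ is a representation of the Lie superalgebra $H$, and it is isomorphic to the Kac module $K_H(L';n;\nu)$, where $L'\cong L$ as a superspace and the action of $H_0=\mathfrak h'$ on $L'$ is trivial.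
   Context: The base field is $\mathbb C$. A finite-dimensional Lie superalgebra $\mathfrak g=\mathfrak g_{\bar0}\oplus\mathfrak g_{\bar1}$ is quasi-reductive if $\mathfrak g_{\bar0}$ is a reductive Lie algebra and $\mathfrak g_{\bar1}$ is a semisimple $\mathfrak g_{\bar0}$-module. It is assumed that $\mathfrak g$ has an even Cartan subalgebra $\mathfrak h$: $\mathfrak h$ is a Cartan subalgebra of $\mathfrak g_{\bar0}$ and the centralizer $\mathfrak g^{\mathfrak h}$ equals $\mathfrak h$. It is of type I if it is $\mathbb Z$-graded, $\mathfrak g=\mathfrak g_{-1}\oplus\mathfrak g_0\oplus\mathfrak g_1$, with $\mathfrak g_0=\mathfrak g_{\bar0}$ and $\mathfrak g_{\pm1}$ odd commutative subalgebras ($[\mathfrak g_1,\mathfrak g_1]=[\mathfrak g_{-1},\mathfrak g_{-1}]=0$) on which $\mathfrak h$ acts diagonally. Let $\mathfrak h'$ be the center of $\mathfrak g_0$ and $\mathfrak h''=[\mathfrak g_0,\mathfrak g_0]\cap\mathfrak h$, so $\mathfrak h=\mathfrak h'\times\mathfrak h''$ and $\mathfrak g_0=[\mathfrak g_0,\mathfrak g_0]\times\mathfrak h'$. Identify $(\mathfrak h')^*$ with $\{\nu\in\mathfrak h^*:\nu|_{\mathfrak h''}=0\}$. Standing convention: modules over $\mathfrak g$ and $\mathfrak g_0$ are locally finite over $\mathfrak h$ with finite-dimensional generalized weight spaces, i.e. they are direct sums of their generalized $\mathfrak h$-weight spaces, each of which is finite-dimensional. Kac modules: for a $\mathfrak g_0$-module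 $M$, extended to $\mathfrak g_0+\mathfrak g_1$ with $\mathfrak g_1$ acting by zero, $K(M):=\mathrm{Ind}_{\mathfrak g_0+\mathfrak g_1}^{\mathfrak g}M$. For $\nu\in(\mathfrak h')^*$, $J_n(\nu)$ is the purely even $n$-dimensional $\mathfrak h$-module with basis $v_1,\dots,v_n$ and action $hv_i=\nu(h)v_{i+1}$ for $i<n$, $hv_n=0$, viewed as a $\mathfrak g_0$-module with zero action of $[\mathfrak g_0,\mathfrak g_0]$. Put $K(L;n;\nu):=K(L\otimes J_n(\nu))$. The superalgebra $H$: let $\iota':\mathfrak g_0\to\mathfrak h'$ be the projection along $\mathfrak g_0=[\mathfrak g_0,\mathfrak g_0]\times\mathfrak h'$. On the superspace $H=\mathfrak g_{-1}\oplus\mathfrak h'\oplus\mathfrak g_1$ (with even part $H_0=\mathfrak h'$) define the Lie superbracket (the subscript $n$ in $[-,-]_n$ is only notation) $$[\mathfrak g_1,\mathfrak g_1]_n=[\mathfrak g_{-1},\mathfrak g_{-1}]_n=0,\quad [a_-,a_+]_n=\iota'([a_-,a_+]),\quad [h,a_\pm]_n=0,\quad [\mathfrak h',\mathfrak h']_n=0$$ for $a_\pm\in\mathfrak g_{\pm1}$, $h\in\mathfrak h'$. It is the direct product of an odd Heisenberg superalgebra and a commutative superalgebra, and is itself of type I. For an $\mathfrak h'$-module $M$, $K_H(M):=\mathrm{Ind}_{\mathfrak h'+\mathfrak g_1}^{H}M$ with $\mathfrak g_1$ acting by zero on $M$, and $K_H(L';n;\nu):=K_H(L'\otimes J_n(\nu))$.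 The family $\rho_t$: for $t\in\mathbb R$, identify all the spaces $J_n(t\nu)$ with $J_n(\nu)$ via the bases $v_1,\dots,v_n$ (so in $J_n(t\nu)$ one has $hv_i=t\nu(h)v_{i+1}$, $hv_n=0$). Thus, as a vector space, $K(L;n;t\nu)$ is canonically identified with $V=L\otimes J_n(\nu)\otimes\Lambda\mathfrak g_{-1}$, and $\rho_t:\mathfrak g\to\mathrm{End}(V)$ denotes the resulting representation. One has $\rho_t(u)=\rho_0(u)$ for $u\in[\mathfrak g_0,\mathfrak g_0]+\mathfrak g_{-1}$, and $\rho_t(u)=\rho_0(u)+t\rho'_t(u)$ for $u\in\mathfrak h'+\mathfrak g_1$, where $\rho'_t(u)=\partial\rho_t(u)/\partial t$ does not depend on $t$. *)

(* Defs.v *)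
From HB Require Import structures.
From mathcomp Require Import all_boot all_order all_algebra.
From mathcomp Require Import generic_quotient ring_quotient finmap monalg.
From mathcomp Require Import all_classical all_reals all_analysis.
From mathcomp.real_closed Require Import complex.
Set Implicit Arguments.
Unset Strict Implicit.
Unset Printing Implicit Defensive.
Import Order.TTheory GRing.Theory Num.Theory numFieldNormedType.Exports.
Local Open Scope classical_set_scope.
Local Open Scope complex_scope.
Local Open Scope quotient_scope.
Local Open Scope ring_scope.

(* The parity of a homogeneous element is a boolean: [false] is even,
   [true] is odd. *)
Record lieSuper (F : fieldType) := LieSuper {
  lsa_sort :> vectType F;
  br : lsa_sort -> lsa_sort -> lsa_sort;
  par : bool -> {vspace lsa_sort};
  par_sum : (par false + par true = fullv)%VS;
  par_cap : (par false :&: par true = 0)%VS;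
  br_linear_l : forall y, linear (br^~ y);
  br_linear_r : forall x, linear (br x);
  br_par : forall i j x y,
    x \in par i -> y \in par j -> br x y \in par (i (+) j);
  br_skew : forall i j x y, x \in par i -> y \in par j ->
    br x y = - ((-1) ^+ (i && j) *: br y x);
  br_jacobi : forall i j x y z, x \in par i -> y \in par j ->
    br x (br y z) = br (br x y) z + (-1) ^+ (i && j) *: br y (br x z) }.

(* A type I superalgebra g = g_{-1} + g_0 + g_1: [gm] is g_{-1}, [gp] is g_1
   and g_0 is the even part [par false].  The remaining grading condition
   [g_{-1}, g_1] <= g_0 is [br_par]. *)
Record typeI (F : fieldType) := TypeI {
  typeI_lsa :> lieSuper F;
  gm : {vspace typeI_lsa};
  gp : {vspace typeI_lsa};
  odd_sum : (gm + gp = par typeI_lsa true)%VS;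
  odd_cap : (gm :&: gp = 0)%VS;
  br0m : forall x y, x \in par typeI_lsa false -> y \in gm -> br x y \in gm;
  br0p : forall x y, x \in par typeI_lsa false -> y \in gp -> br x y \in gp;
  brmm : forall x y, x \in gm -> y \in gm -> br x y = 0;
  brpp : forall x y, x \in gp -> y \in gp -> br x y = 0 }.

Section Structure.
Variables (F : fieldType) (g : lieSuper F).
Implicit Types U W : {vspace g}.
Local Notation g0 := (par g false).

HB.instance Definition _ (x : g) :=
  @GRing.isLinear.Build F g g *:%R (br x) (br_linear_r x).

Definition brr (y x : g) := br x y.

HB.instance Definition _ (y : g) :=
  @GRing.isLinear.Build F g g *:%R (brr y) (br_linear_l y).

Lemma br0l y : br 0 y = 0 :> g. Proof. exact: (linear0 (brr y)). Qed.
Lemma br0r x : br x 0 = 0 :> g. Proof. exact: (linear0 (br x)). Qed.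

Definition ad_stable W := forall x w, x \in g0 -> w \in W -> br x w \in W.

Definition ad_semisimple U := forall W, (W <= U)%VS -> ad_stable W ->
  exists W', [/\ ad_stable W', (W + W' = U)%VS & (W :&: W' = 0)%VS].

(* g_0 is reductive when its adjoint representation is semisimple. *)
Definition quasi_reductive := ad_semisimple g0 /\ ad_semisimple (par g true).

Definition brv U W : {vspace g} :=
  span [seq br x y | x <- vbasis U, y <- vbasis W].

Definition lie_nilpotent U := exists k, iter k (brv U) U = 0%VS.

Definition cartan_of_even (hh : {vspace g}) :=
  [/\ (hh <= g0)%VS, lie_nilpotent hh &
    forall x, x \in g0 -> (forall h, h \in hh -> br x h \in hh) -> x \in hh].

Definition even_cartan (hh : {vspace g}) :=
  cartan_of_even hh /\
  forall x, x \in hh <-> forall h, h \in hh -> br h x = 0.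

Definition diagonal_on (hh U : {vspace g}) := exists s : seq g,
  span s = U /\
  forall x, x \in s -> forall h, h \in hh -> exists c : F, br h x = c *: x.

Definition lcenter : {vspace g} :=
  (g0 :&: \bigcap_(i < \dim g0) lker (linfun (br (vbasis g0)`_i)))%VS.

Lemma lcenterP x :
  reflect (x \in g0 /\ forall y, y \in g0 -> br y x = 0) (x \in lcenter).
Proof.
apply: (iffP idP) => [|[x0 xC]]; rewrite memv_cap.
  case/andP=> -> /subv_bigcapP xC; split=> // y y0.
  have zC i : (i < \dim g0)%N -> br (vbasis g0)`_i x = 0.
    move=> ilt; have /(_ (Ordinal ilt) isT) := xC.
    by rewrite -memvE memv_ker lfunE => /eqP.
  rewrite (coord_vbasis y0) -[br _ x]/(brr x _) linear_sum big1 // => i _.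
  by rewrite linearZ /= /brr zC ?scaler0.
rewrite x0 /=; apply/subv_bigcapP=> i _; rewrite -memvE memv_ker lfunE /=.
by rewrite xC // vbasis_mem // mem_nth // size_tuple.
Qed.

(* The projection g_0 -> h' along [g_0, g_0]; when g_0 is reductive the two
   subspaces are complementary in g_0. *)
Definition iota' : 'End(g) := daddv_pi lcenter (brv g0 g0).

(* The projection g -> g_0 along g_1bar. *)
Definition pi0 : 'End(g) := daddv_pi g0 (par g true).

End Structure.

(* The superalgebra H = g_{-1} + h' + g_1: the triple (a, h, b) stands for
   a + h + b. *)
Section SuperalgebraH.
Variables (F : fieldType) (g : typeI F).
Local Notation h' := (lcenter g).

Definition Hsort : vectType F :=
  (subvs_of (gm g) * subvs_of h' * subvs_of (gp g))%type.

Definition Hbr (u v : Hsort) : Hsort :=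
  (0, vsproj h' (iota' g (br (vsval u.1.1) (vsval v.2) +
                          br (vsval u.2) (vsval v.1.1))), 0).

Definition Hgm : {vspace Hsort} :=
  (lker (linfun (snd \o fst : Hsort -> _)) :&: lker (linfun (snd : Hsort -> _)))%VS.
Definition Hgp : {vspace Hsort} := lker (linfun (fst : Hsort -> _)).
Definition Hpar (i : bool) : {vspace Hsort} :=
  if i then lker (linfun (snd \o fst : Hsort -> _))
  else (lker (linfun (fst \o fst : Hsort -> _)) :&:
        lker (linfun (snd : Hsort -> _)))%VS.

Lemma HgmE u : (u \in Hgm) = (u.1.2 == 0) && (u.2 == 0).
Proof. by rewrite memv_cap !memv_ker !lfunE. Qed.

Lemma HgpE u : (u \in Hgp) = (u.1 == 0).
Proof. by rewrite memv_ker lfunE. Qed.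

Lemma HparE i u : (u \in Hpar i) =
  if i then u.1.2 == 0 else (u.1.1 == 0) && (u.2 == 0).
Proof. by case: i; rewrite ?memv_cap !memv_ker !lfunE. Qed.

Lemma HtripleD (a a' : subvs_of (gm g)) (h k : subvs_of h')
    (b b' : subvs_of (gp g)) :
  (a, h, b) + (a', k, b') = (a + a', h + k, b + b') :> Hsort.
Proof. by []. Qed.

Lemma HtripleZ c (a : subvs_of (gm g)) (h : subvs_of h')
    (b : subvs_of (gp g)) :
  c *: ((a, h, b) : Hsort) = (c *: a, c *: h, c *: b).
Proof. by []. Qed.

Lemma Hpar_sum : (Hpar false + Hpar true = fullv)%VS.
Proof.
apply/eqP; rewrite eqEsubv subvf; apply/subvP => -[[a h] b] _.
apply/memv_addP; exists (0, h, 0); first by rewrite HparE !eqxx.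
exists (a, 0, b); first by rewrite HparE eqxx.
by rewrite HtripleD !add0r addr0.
Qed.

Lemma Hpar_cap : (Hpar false :&: Hpar true = 0)%VS.
Proof.
apply/eqP; rewrite -subv0; apply/subvP => -[[a h] b].
by rewrite memv_cap !HparE memv0 /= => /andP[/andP[/eqP-> /eqP->] /eqP->].
Qed.

Lemma Hbr_linear_r u : linear (Hbr u).
Proof.
move=> c [[a h] b] [[a' k] b'].
rewrite /Hbr HtripleZ HtripleD /= HtripleZ HtripleD !scaler0 !addr0.
by rewrite !linearP addrACA -scalerDr 2!linearP.
Qed.

Lemma Hbr_linear_l v : linear (Hbr^~ v).
Proof.
move=> c [[a h] b] [[a' k] b'].
rewrite /Hbr HtripleZ HtripleD /= HtripleZ HtripleD !scaler0 !addr0.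
by rewrite !br_linear_l addrACA -scalerDr 2!linearP.
Qed.

Lemma gm_odd x : x \in gm g -> x \in par g true.
Proof. by rewrite -odd_sum; apply/subvP/addvSl. Qed.

Lemma gp_odd x : x \in gp g -> x \in par g true.
Proof. by rewrite -odd_sum; apply/subvP/addvSr. Qed.

Lemma Hbr_par i j u v :
  u \in Hpar i -> v \in Hpar j -> Hbr u v \in Hpar (i (+) j).
Proof.
rewrite !HparE /Hbr; case: i j => -[] /=; rewrite ?eqxx //.
- by move=> _ /andP[/eqP-> /eqP->]; rewrite !linear0 addr0 !linear0.
by move=> /andP[/eqP-> /eqP->] _; rewrite !(linear0, br0l, br0r, addr0).
Qed.

Lemma Hbr_even i u v : u \in Hpar i -> v \in Hpar false -> Hbr u v = 0.
Proof.
rewrite /Hbr !HparE => _ /andP[/eqP-> /eqP->].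
by rewrite !(linear0, br0l, br0r, addr0).
Qed.

Lemma Hbr_sym u v : Hbr u v = Hbr v u.
Proof.
rewrite /Hbr addrC.
rewrite (br_skew (gm_odd (subvsP u.1.1)) (gp_odd (subvsP v.2))).
rewrite (br_skew (gp_odd (subvsP u.2)) (gm_odd (subvsP v.1.1))).
by rewrite /= expr1 !scaleN1r !opprK.
Qed.

Lemma Hbr_skew i j u v : u \in Hpar i -> v \in Hpar j ->
  Hbr u v = - ((-1) ^+ (i && j) *: Hbr v u).
Proof.
case: i j => -[] ui vj /=; first by rewrite expr1 scaleN1r opprK Hbr_sym.
- by rewrite [Hbr v u]Hbr_sym (Hbr_even ui vj) scaler0 oppr0.
- by rewrite Hbr_sym (Hbr_even vj ui) scaler0 oppr0.
by rewrite [Hbr v u]Hbr_sym (Hbr_even ui vj) scaler0 oppr0.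
Qed.

Lemma Hbr_brr u v w : Hbr u (Hbr v w) = 0.
Proof. by rewrite /Hbr /= !(linear0, br0l, br0r, addr0). Qed.

Lemma Hbr_jacobi i j u v w : u \in Hpar i -> v \in Hpar j ->
  Hbr u (Hbr v w) = Hbr (Hbr u v) w + (-1) ^+ (i && j) *: Hbr v (Hbr u w).
Proof. by move=> _ _; rewrite [Hbr (Hbr _ _) w]Hbr_sym !Hbr_brr scaler0 addr0. Qed.

Definition Hlsa : lieSuper F := LieSuper Hpar_sum Hpar_cap
  Hbr_linear_l Hbr_linear_r Hbr_par Hbr_skew Hbr_jacobi.

Lemma Hodd_sum : (Hgm + Hgp = Hpar true)%VS.
Proof.
apply/vspaceP => u; rewrite HparE; apply/memv_addP/eqP.
  move=> [[[a h] b] + [[[a' k] b'] + ->]].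
  by rewrite HgmE HgpE /= => /andP[/eqP-> _] /eqP[_ ->]; rewrite addr0.
case: u => [[a h] b] /= ->; exists (a, 0, 0); first by rewrite HgmE /= !eqxx.
by exists (0, 0, b); rewrite ?HgpE //= HtripleD !add0r !addr0.
Qed.

Lemma Hodd_cap : (Hgm :&: Hgp = 0)%VS.
Proof.
apply/eqP; rewrite -subv0; apply/subvP => -[[a h] b].
by rewrite memv_cap HgmE HgpE memv0 /= => /andP[/andP[_ /eqP->] /eqP->].
Qed.

Lemma Hbr0 (U : {vspace Hsort}) u v :
  u \in Hpar false -> v \in U -> Hbr u v \in U.
Proof.
rewrite /Hbr HparE => /andP[/eqP-> /eqP->] _.
by rewrite !(linear0, br0l, br0r, addr0) mem0v.
Qed.

Lemma Hbrmm u v : u \in Hgm -> v \in Hgm -> Hbr u v = 0.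
Proof.
rewrite /Hbr !HgmE => /andP[_ /eqP->] /andP[_ /eqP->].
by rewrite !(linear0, br0l, br0r, addr0).
Qed.

Lemma Hbrpp u v : u \in Hgp -> v \in Hgp -> Hbr u v = 0.
Proof.
rewrite /Hbr !HgpE => /eqP-> /eqP->.
by rewrite !(linear0, br0l, br0r, addr0).
Qed.

Definition Hg : typeI F := @TypeI F Hlsa Hgm Hgp Hodd_sum Hodd_cap
  (@Hbr0 Hgm) (@Hbr0 Hgp) Hbrmm Hbrpp.

End SuperalgebraH.

Definition subspace (F : fieldType) (V : lmodType F) (P : set V) :=
  P 0 /\ forall (a : F) u v, P u -> P v -> P (a *: u + v).

Definition superspace (F : fieldType) (V : lmodType F) (vp : bool -> set V) :=
  (forall i, subspace (vp i)) /\
  forall v, exists! w : V * V, [/\ vp false w.1, vp true w.2 & v = w.1 + w.2].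

(* [act] makes V, graded by [vp], a module over the subalgebra [p] of g; the
   values of [act] outside [p] are irrelevant. *)
Record is_module (F : fieldType) (g : lieSuper F) (p : {vspace g})
    (V : lmodType F) (vp : bool -> set V) (act : g -> V -> V) : Prop :=
  IsModule {
  mod_superspace : superspace vp;
  mod_linear : forall x, x \in p -> linear (act x);
  mod_linear_l : forall (a : F) x y v, x \in p -> y \in p ->
    act (a *: x + y) v = a *: act x v + act y v;
  mod_par : forall i j x v, x \in p -> x \in par g i -> vp j v ->
    vp (i (+) j) (act x v);
  mod_br : forall i j x y v, x \in p -> y \in p ->
    x \in par g i -> y \in par g j ->
    act (br x y) v = act x (act y v) - (-1) ^+ (i && j) *: act y (act x v) }.

Section Weights.
Variables (F : fieldType) (g : lieSuper F) (hh : {vspace g}).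
Variables (V : lmodType F) (act : g -> V -> V).

Definition gweight (lam : 'Hom(subvs_of hh, F^o)) : set V :=
  [set v | forall h : subvs_of hh,
     exists k, iter k (fun w => act (vsval h) w - lam h *: w) v = 0].

Definition finite_dim (A : set V) :=
  exists s : seq V, forall v, A v ->
    exists c : 'I_(size s) -> F, v = \sum_i c i *: s`_i.

(* V is the direct sum of its generalized h-weight spaces, each of which is
   finite-dimensional. *)
Definition weight_finite :=
  [/\ forall lam, finite_dim (gweight lam),
      forall v, exists (s : seq 'Hom(subvs_of hh, F^o)) w,
        [/\ uniq s, forall lam, gweight lam (w lam)
           & v = \sum_(lam <- s) w lam]
    & forall (s : seq 'Hom(subvs_of hh, F^o)) w, uniq s ->
        (forall lam, gweight lam (w lam)) -> \sum_(lam <- s) w lam = 0 ->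
        forall lam, lam \in s -> w lam = 0].

End Weights.

Section LinearQuotient.
Variables (F : fieldType) (V : lmodType F) (A : set V).

Definition lspan : set V :=
  [set v | forall P : set V, subspace P -> A `<=` P -> P v].

Definition lspan_pred : pred V := fun v => `[< lspan v >].

Lemma lspan_subspace : subspace lspan.
Proof.
split=> [P [] //|a u v uA vA P sP AP].
by case: (sP) => _; apply; [apply: uA | apply: vA].
Qed.

Lemma lspan_submod : submod_closed lspan_pred.
Proof.
have [l0 lD] := lspan_subspace.
by split=> [|a u v /asboolP uA /asboolP vA]; apply/asboolP => //; apply: lD.
Qed.

HB.instance Definition _ :=
  GRing.isSubmodClosed.Build F V lspan_pred lspan_submod.

Definition lquot := Quotient.quot (GRing.ZmodClosed.clone V lspan_pred _).

HB.instance Definition _ := EqQuotient.on lquot.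
HB.instance Definition _ := ZmodQuotient.on lquot.

Lemma lquotD u v : \pi_lquot (u + v) = \pi_lquot u + \pi_lquot v.
Proof. exact: (Quotient.pi_add _ u v). Qed.

Definition lquot_scale (a : F) (q : lquot) : lquot := \pi_lquot (a *: repr q).

Lemma lquot_eq u v : lspan (u - v) -> \pi_lquot u = \pi_lquot v.
Proof. by move=> uv; apply/eqP; rewrite piE Quotient.equivE; apply/asboolP. Qed.

Lemma lquot_eqP u v : \pi_lquot u = \pi_lquot v -> lspan (u - v).
Proof. by move/eqP; rewrite piE Quotient.equivE => /asboolP. Qed.

Lemma lquot_scaleE a u : lquot_scale a (\pi_lquot u) = \pi_lquot (a *: u).
Proof.
apply: lquot_eq; rewrite -scalerBr -[_ *: _]addr0.
have [l0 lD] := lspan_subspace.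
by apply: lD => //; apply: lquot_eqP; rewrite reprK.
Qed.

Lemma lquot_scaleA a b q : lquot_scale a (lquot_scale b q) = lquot_scale (a * b) q.
Proof. by elim/quotW: q => u; rewrite (lquot_scaleE b u) !lquot_scaleE scalerA. Qed.

Lemma lquot_scale1 : left_id 1 lquot_scale.
Proof. by elim/quotW=> u; rewrite lquot_scaleE scale1r. Qed.

Lemma lquot_scaleDr : right_distributive lquot_scale +%R.
Proof.
move=> a; elim/quotW=> u; elim/quotW=> v.
by rewrite -lquotD !lquot_scaleE scalerDr lquotD.
Qed.

Lemma lquot_scaleDl q : {morph lquot_scale^~ q : a b / a + b}.
Proof. by move=> a b; elim/quotW: q => u; rewrite !lquot_scaleE scalerDl lquotD. Qed.

HB.instance Definition _ := GRing.Zmodule_isLmodule.Build F lquot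
  lquot_scaleA lquot_scale1 lquot_scaleDr lquot_scaleDl.

Definition lpi (v : V) : lquot := \pi_lquot v.

Lemma lpi_linear : linear lpi.
Proof. by move=> a u v; rewrite /lpi lquotD -lquot_scaleE. Qed.

HB.instance Definition _ := GRing.isLinear.Build F V lquot *:%R lpi lpi_linear.

End LinearQuotient.

Arguments lspan {F V} A.
Arguments lquot {F V} A.
Arguments lpi {F V} A v.

(* Ind_p^g M = U(g) (x)_{U(p)} M by generators and relations: the generator
   (x_1 ... x_k, m) is x_1 ... x_k (x) m, the first three families of
   relations give T(g) (x) M, the fourth passes to U(g), the last one is the
   balancing over U(p). *)
Section Induction.
Variables (F : fieldType) (g : lieSuper F) (p : {vspace g}).
Variables (M : lmodType F) (act : g -> M -> M).

Definition ind_gen : choiceType := (seq g * M)%type.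
Definition ind_free : lmodType F := {malg F[ind_gen]}.
Definition gen (w : seq g) (m : M) : ind_free := << ((w, m) : ind_gen) >>.

Inductive ind_rel : set ind_free :=
| RelLetter w w' (a : F) x y m : ind_rel
    (gen (w ++ a *: x + y :: w') m
     - (a *: gen (w ++ x :: w') m + gen (w ++ y :: w') m))
| RelVector w (a : F) m m' : ind_rel
    (gen w (a *: m + m') - (a *: gen w m + gen w m'))
| RelBracket w w' i j x y m : x \in par g i -> y \in par g j -> ind_rel
    (gen (w ++ [:: x, y & w']) m
     - (-1) ^+ (i && j) *: gen (w ++ [:: y, x & w']) m
     - gen (w ++ br x y :: w') m)
| RelBalance w x m : x \in p -> ind_rel
    (gen (rcons w x) m - gen w (act x m)).

Definition Ind : lmodType F := lquot ind_rel.

Definition ind_word (w : seq g) (m : M) : Ind := lpi ind_rel (gen w m).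

Definition free_act (x : g) (q : ind_free) : ind_free :=
  \sum_(k <- msupp q) q@_k *: gen (x :: k.1) k.2.

Definition ind_act (x : g) (q : Ind) : Ind :=
  lpi ind_rel (free_act x (repr q)).

Definition ind_par (mp : bool -> set M) (b : bool) : set Ind :=
  lspan [set q | exists w (e : seq bool) c m,
    [/\ all2 (fun x i => x \in par g i) w e, mp c m,
        foldr addb c e = b & q = ind_word w m]].

Lemma free_act_sub x q (d : {fset ind_gen}) : (msupp q `<=` d)%fset ->
  free_act x q = \sum_(k <- d) q@_k *: gen (x :: k.1) k.2.
Proof.
move=> qd; rewrite /free_act (big_fset_incl _ qd) // => k _ kq.
by rewrite mcoeff_outdom // scale0r.
Qed.

Lemma free_act_linear x : linear (free_act x).
Proof.
move=> a q r; pose d := (msupp q `|` msupp r `|` msupp (a *: q + r))%fset.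
rewrite !(@free_act_sub x _ d) ?fsubsetUr //; last first.
- by rewrite /d -fsetUA fsubsetUl.
- by rewrite /d fsetUAC fsubsetUr.
rewrite scaler_sumr -big_split; apply: eq_bigr => k _ /=.
by rewrite mcoeffD mcoeffZ scalerDl scalerA.
Qed.

HB.instance Definition _ x := GRing.isLinear.Build F ind_free ind_free *:%R
  (free_act x) (free_act_linear x).

Lemma free_act_gen x w m : free_act x (gen w m) = gen (x :: w) m.
Proof.
rewrite (@free_act_sub x _ [fset ((w, m) : ind_gen)]%fset) ?msuppU_le //.
by rewrite big_seq_fset1 mcoeffUU scale1r.
Qed.

Lemma free_act_rel x q : ind_rel q -> ind_rel (free_act x q).
Proof.
have fB u v : free_act x (u - v) = free_act x u - free_act x v.
  exact: linearB.
have fD u v : free_act x (u + v) = free_act x u + free_act x v.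
  exact: linearD.
have fZ a u : free_act x (a *: u) = a *: free_act x u by exact: linearZ.
case=> [w w' a y z m|w a m m'|w w' i j y z m yi zj|w y m yp].
- by rewrite fB fD fZ !free_act_gen; exact: (RelLetter (x :: w)).
- by rewrite fB fD fZ !free_act_gen; exact: (RelVector (x :: w)).
- rewrite 2!fB fZ !free_act_gen; exact: (RelBracket (x :: w)).
by rewrite fB !free_act_gen; exact: (@RelBalance (x :: w)).
Qed.

Lemma ind_act_pi x q : ind_act x (lpi ind_rel q) = lpi ind_rel (free_act x q).
Proof.
rewrite /ind_act; apply: lquot_eq; rewrite -linearB.
have : lspan ind_rel (repr (lpi ind_rel q) - q).
  by apply: lquot_eqP; rewrite reprK.
apply: (_ : lspan ind_rel `<=` [set q | lspan ind_rel (free_act x q)]) => r.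
apply; last by move=> s /free_act_rel srel P _; apply.
have [l0 lD] := lspan_subspace ind_rel.
by split=> [|a u v]; rewrite /= ?linear0 // linearP; apply: lD.
Qed.

Lemma ind_act_linear x : linear (ind_act x).
Proof.
move=> a; elim/quotW=> u; elim/quotW=> v.
have := ind_act_pi x; rewrite /lpi => E.
rewrite -![\pi_Ind _]/(lpi ind_rel _) -linearP !ind_act_pi.
by rewrite linearP linearP.
Qed.

Lemma ind_act_word x w m : ind_act x (ind_word w m) = ind_word (x :: w) m.
Proof. by rewrite /ind_word ind_act_pi free_act_gen. Qed.

End Induction.

(* M (x) Lambda g_{-1} in coordinates: with e_1, ..., e_d the basis of g_{-1},
   the function f stands for the sum over S = {i_1 < ... < i_k} of
   f(S) (x) e_{i_1} /\ ... /\ e_{i_k}. *)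
Notation extmod g M := {ffun {set 'I_(\dim (gm g))} -> M}.

Section Kac.
Variables (F : fieldType) (g : typeI F) (M : lmodType F) (act : g -> M -> M).

Definition kac_act (x : g) (m : M) : M := act (pi0 g x) m.

(* K(M), for the action [act] of g_0 on M; on g_0 + g_1 the projection [pi0]
   kills g_1. *)
Definition kac : lmodType F := Ind (par g false + gp g)%VS kac_act.

Definition kac_rep (x : g) : kac -> kac := ind_act x.

Definition kac_par (mp : bool -> set M) (b : bool) : set kac := ind_par mp b.

Definition ext_par (mp : bool -> set M) (b : bool) : set (extmod g M) :=
  [set f : extmod g M | forall S : {set 'I__}, mp (b (+) odd #|S|) (f S)].

Definition gm_word (S : {set 'I_(\dim (gm g))}) : seq g :=
  [seq (vbasis (gm g))`_i | i : 'I_(\dim (gm g)) <- enum S].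

(* The identification of M (x) Lambda g_{-1} with K(M), sending
   m (x) y_1 /\ ... /\ y_k to y_1 ... y_k (x) m; it is bijective by PBW. *)
Definition kac_iso (f : extmod g M) : kac :=
  \sum_(S : {set 'I_(\dim (gm g))}) ind_word _ kac_act (gm_word S) (f S).

Definition kac_iso_inv (q : kac) : extmod g M := xget 0 [set f | kac_iso f = q].

Definition kac_ext_rep (x : g) (f : extmod g M) : extmod g M :=
  kac_iso_inv (kac_rep x (kac_iso f)).

End Kac.

(* L (x) C^n in coordinates: f stands for the sum of the f(i) (x) v_i.  An
   element acting by [a] on L and by v_i |-> \sum_j A i j v_j on C^n acts by
   [tensor_act a A]. *)
Definition tensor_act (F : fieldType) (L : lmodType F) (n : nat)
    (a : L -> L) (A : 'M[F]_n) (f : {ffun 'I_n -> L}) : {ffun 'I_n -> L} :=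
  [ffun j => a (f j) + \sum_i A i j *: f i].

Definition tensor_par (F : fieldType) (L : lmodType F) (n : nat)
    (lp : bool -> set L) (b : bool) : set {ffun 'I_n -> L} :=
  [set f : {ffun 'I_n -> L} | forall i, lp b (f i)].

(* The matrix of v_i |-> c v_{i+1}, v_n |-> 0. *)
Definition J_mx (F : fieldType) (n : nat) (c : F) : 'M[F]_n :=
  \matrix_(i, j) (if (j == i.+1 :> nat) then c else 0).

Section JordanKac.
Variables (F : fieldType) (g : typeI F) (L : lmodType F) (n : nat).
Local Notation h' := (lcenter g).
Implicit Type nu : 'Hom(subvs_of h', F^o).

(* The g_0-module L (x) J_n(nu); [g_0, g_0] acts by zero on J_n(nu). *)
Definition LJ_act (act : g -> L -> L) nu (x : g) :=
  tensor_act (act x) (J_mx n (nu (vsproj h' (iota' g x)))).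

(* The h'-module L' (x) J_n(nu), with L' = L with trivial action. *)
Definition HLJ_act nu (u : Hg g) :=
  tensor_act (fun _ : L => 0) (J_mx n (nu u.1.2)).

End JordanKac.

(* The derivative at t of a curve in a complex vector space V, computed in
   coordinates of a finite-dimensional subspace containing the curve (V itself
   carries no topology). *)
Definition is_curve_derive (R : realType) (V : lmodType R[i])
    (c : R -> V) (t : R) (d : V) :=
  exists k (e : 'I_k -> V) (f : R -> 'I_k -> R[i]) (f' : 'I_k -> R[i]),
    [/\ forall s, c s = \sum_i f s i *: e i,
        forall i, is_derive t 1 (fun s => complex.Re (f s i)) (complex.Re (f' i)) /\
                  is_derive t 1 (fun s => complex.Im (f s i)) (complex.Im (f' i))
      & d = \sum_i f' i *: e i].

Definition curve_derive (R : realType) (V : lmodType R[i]) (c : R -> V) (t : R) :=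
  xget 0 [set d | is_curve_derive c t d].

Section Family.
Variables (R : realType) (g : typeI R[i]) (L : lmodType R[i]) (n : nat).
Variables (act : g -> L -> L) (nu : 'Hom(subvs_of (lcenter g), R[i]^o)).

(* V = L (x) J_n(nu) (x) Lambda g_{-1} *)
Local Notation LJext := (extmod g {ffun 'I_n -> L}).

Definition rho (t : R) (x : g) : LJext -> LJext :=
  kac_ext_rep (LJ_act (n := n) act (t%:C *: nu)) x.

(* The derivative in End(V) is taken pointwise on V. *)
Definition drho (t : R) (x : g) (v : LJext) : LJext :=
  curve_derive (fun s => rho s x v) t.

Definition phi (t : R) (u : Hg g) (v : LJext) : LJext :=
  rho 0 (vsval u.1.1) v + drho t (vsval u.2) v + drho t (vsval u.1.2) v.

End Family.

(* Main.v *)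
Require Import Defs.
From HB Require Import structures.
From mathcomp Require Import all_boot all_order all_algebra ssrAC.
From mathcomp Require Import generic_quotient finmap monalg.
From mathcomp Require Import all_classical all_reals all_analysis.
From mathcomp.real_closed Require Import complex.
Set Implicit Arguments.
Unset Strict Implicit.
Unset Printing Implicit Defensive.
Import Order.TTheory GRing.Theory Num.Theory numFieldNormedType.Exports.
Local Open Scope classical_set_scope.
Local Open Scope complex_scope.
Local Open Scope ring_scope.

(* Everything is made explicit on M (x) Lambda g_{-1}, with the creation and
   annihilation operators c_i, a_i attached to a basis (X_i) of g_{-1}:
   y in g_{-1} acts by c_y, x in g_0 by x + sum_j c_{[x,X_j]} a_j, and
   a in g_1 by sum_i ([a,X_i] + 1/2 sum_j c_{[[a,X_i],X_j]} a_j) a_i.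
   An operator that supercommutes with the c_i and kills the vacuum vectors is
   zero, so the bracket relations have to be checked only against the c_i, where
   they reduce to the Jacobi identity.  Sending m (x) X_{i_1} /\ ... /\ X_{i_k}
   to X_{i_1} ... X_{i_k} (x) m therefore identifies this module with K(M).
   On L (x) J_n(t nu) the element x of g_0 acts by x + t nu(iota' x) N, with N the
   nilpotent Jordan block; so rho_t is affine in t, with slope nu(h) N for h in h'
   and sum_i nu(iota' [a,X_i]) N a_i for a in g_1.  Since the double brackets
   [[a,X_i],X_j] vanish in H, these are the operators of K_H(L'; n; nu). *)

(** * Creation and annihilation operators *)

Section Fermions.
Variables (F : fieldType) (d : nat) (M : lmodType F).
Local Notation E := {ffun {set 'I_d} -> M}.
Implicit Types (f : E) (T : {set 'I_d}) (i j : 'I_d).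

(** The sign of moving [e_i] past the smaller elements of [T]. The inequality is strict, so [T],
    [i |: T] and [T :\ i] all give the same sign, and [create] and [annih] can share it. *)
Definition csgn i T : F := (-1) ^+ #|[set k in T | (k < i)%N]|.

Definition create i f : E :=
  [ffun T : {set 'I_d} => if i \in T then csgn i T *: f (T :\ i) else 0].
Definition annih i f : E :=
  [ffun T : {set 'I_d} => if i \in T then 0 else csgn i T *: f (i |: T)].
Definition monom T (m : M) : E := [ffun U => if U == T then m else 0].

Lemma create_linear i : linear (create i).
Proof.
move=> a f f'; apply/ffunP => T; rewrite !ffunE.
case: ifP => _; last by rewrite scaler0 addr0.
by rewrite scalerDr !scalerA mulrC.
Qed.
HB.instance Definition _ i := GRing.isLinear.Build F E E *:%R
  (create i) (create_linear i).

Lemma annih_linear i : linear (annih i).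
Proof.
move=> a f f'; apply/ffunP => T; rewrite !ffunE.
case: ifP => _; first by rewrite scaler0 addr0.
by rewrite scalerDr !scalerA mulrC.
Qed.
HB.instance Definition _ i := GRing.isLinear.Build F E E *:%R
  (annih i) (annih_linear i).

Lemma monom_linear T : linear (monom T).
Proof.
move=> a m m'; apply/ffunP => U; rewrite !ffunE.
by case: ifP => // _; rewrite scaler0 addr0.
Qed.
HB.instance Definition _ T := GRing.isLinear.Build F M E *:%R
  (monom T) (monom_linear T).

Lemma csgnU1 i j T : i \notin T -> csgn j (i |: T) = (-1) ^+ (i < j)%N * csgn j T.
Proof.
move=> iT; rewrite /csgn -exprD; case: ltnP => ij.
  have -> : [set k in i |: T | (k < j)%N] = i |: [set k in T | (k < j)%N].
    by apply/setP => k; rewrite !inE; case: eqP => //= ->; rewrite ij.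
  by rewrite cardsU1 !inE (negbTE iT).
congr (_ ^+ _); apply: eq_card => k; rewrite !inE.

by case: eqP => //= ->; rewrite ltnNge ij (negbTE iT).
Qed.

Lemma csgnD1 i j T : i \in T -> csgn j (T :\ i) = (-1) ^+ (i < j)%N * csgn j T.
Proof.
move=> iT; rewrite -[in RHS](finset.setD1K iT) csgnU1 ?finset.setD11 //.
by rewrite mulrA -exprD addnn -muln2 mulnC exprM sqrrN !expr1n mul1r.
Qed.

Lemma csgn_sqr i T : csgn i T * csgn i T = 1.
Proof. by rewrite -expr2 -exprM mulnC exprM sqrrN !expr1n. Qed.

(** Exactly one of [i < j] and [j < i] holds; this is the source of the minus signs in [createC] and
    [annih_create]. *)
Lemma sgn_ltn i j : i != j -> (-1) ^+ (i < j)%N = - (-1) ^+ (j < i)%N :> F.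
Proof.
by rewrite -(inj_eq val_inj); case: ltngtP => //= _ _; rewrite ?expr1 ?expr0 ?opprK.
Qed.

Lemma createC i j f : create i (create j f) = - create j (create i f).
Proof.
apply/ffunP => T; rewrite !ffunE.
have [<-|ij] := eqVneq i j; first by rewrite finset.setD11 scaler0 if_same oppr0.
rewrite !inE ij eq_sym ij /=.
case: (boolP (i \in T)) => iT; case: (boolP (j \in T)) => jT;
  rewrite ?scaler0 ?oppr0 //.
rewrite !csgnD1 // !scalerA -scaleNr finset.setDDl finset.setUC -finset.setDDl.
congr (_ *: _).
by rewrite (sgn_ltn ij) mulNr mulrN mulrCA [in RHS]mulrCA [csgn i T * _]mulrC.
Qed.

(** The canonical anticommutation relation. For [i = j] exactly one of the two products survives at
    each [T], according to whether [i] lies in [T], and its two signs cancel; for distinct indices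
    the sign comes from [sgn_ltn]. *)
Lemma annih_create i j f :
  annih i (create j f) = (i == j)%:R *: f - create j (annih i f).
Proof.
apply/ffunP => T; rewrite !ffunE.
have [<-|ij] := eqVneq i j.
  rewrite finset.setU11 scale1r finset.setD11; case: (boolP (i \in T)) => iT.
    rewrite csgnD1 ?ltnn ?expr0 ?mul1r /= ?finset.setD1K //.
    by rewrite scalerA csgn_sqr scale1r subrr.
  by rewrite csgnU1 // ltnn expr0 mul1r scalerA csgn_sqr scale1r finset.setU1K // subr0.
rewrite !inE (negbTE ij) eq_sym (negbTE ij) /= scale0r add0r.
case: (boolP (i \in T)) => iT; case: (boolP (j \in T)) => jT;
  rewrite ?scaler0 ?oppr0 //.
have -> : (i |: T) :\ j = i |: T :\ j.
  by apply/setP => k; rewrite !inE; case: (eqVneq k i) => // ->; rewrite ij.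
rewrite csgnU1 // csgnD1 // !scalerA -scaleNr; congr (_ *: _).
by rewrite (sgn_ltn ij) mulNr mulrN mulrCA [in RHS]mulrCA [csgn i T * _]mulrC.
Qed.

Lemma annih_vac i m : annih i (monom finset.set0 m) = 0.
Proof.
apply/ffunP => T; rewrite !ffunE; case: ifP => // _.
case: eqP => [T0|]; last by rewrite scaler0.
by have := finset.setU11 i T; rewrite T0 inE.
Qed.

Lemma create_monom i T m : i \notin T ->
  create i (monom T m) = csgn i T *: monom (i |: T) m.
Proof.
move=> iT; apply/ffunP => U; rewrite !ffunE.
case: (boolP (i \in U)) => iU; last first.
  by case: eqP => [UT|]; rewrite ?scaler0 //; rewrite UT finset.setU11 in iU.
have -> : (U == i |: T) = (U :\ i == T).
  by apply/eqP/eqP => [->|<-]; rewrite ?finset.setU1K // finset.setD1K.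
case: eqP => [<-|]; last by rewrite !scaler0.
by rewrite csgnD1 // ltnn mul1r.
Qed.

Lemma ffun_monomE f : f = \sum_T monom T (f T).
Proof.
apply/ffunP => U; rewrite sum_ffunE (bigD1 U) //= ffunE eqxx big1 ?addr0 // => T.
by rewrite eq_sym ffunE => /negbTE->.
Qed.

(** The vacuum vectors [monom set0 m] generate everything under the creation operators. An identity
    of operators thus has to be checked on the vacuum and carried past each [create i]. *)
Lemma monom_ind (P : E -> Prop) :
  (forall a u v, P u -> P v -> P (a *: u + v)) ->
  (forall m, P (monom finset.set0 m)) -> (forall i f, P f -> P (create i f)) ->
  forall f, P f.
Proof.
move=> PD P0 Pc.
have P00 : P 0 by have := P0 0; rewrite linear0.
have Pm T m : P (monom T m).
  have [k] := ubnP #|T|; elim: k T => // k IH T Tk.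
  case: (set_0Vmem T) => [->|[i iT]]; first exact: P0.
  (* The factor 1 is split into two equal signs, one of which [create_monom] absorbs. *)
  rewrite -(finset.setD1K iT) -[monom _ _]scale1r -(csgn_sqr i (T :\ i)) -scalerA.
  rewrite -create_monom ?finset.setD11 // -[_ *: _]addr0; apply: PD => //; apply: Pc.
  by apply: IH; move: Tk; rewrite (cardsD1 i) iT.
move=> f; rewrite [f]ffun_monomE; elim/big_ind: _ => // u v Pu Pv.
by rewrite -[u]scale1r; apply: PD.
Qed.

End Fermions.

(** * Projections onto the three graded pieces of g *)

Section TypeI.
Variables (F : fieldType) (g : typeI F).

Lemma pi0_id x : x \in par g false -> pi0 g x = x.
Proof. by apply: daddv_pi_id; apply: par_cap. Qed.

Lemma pi0_mem x : pi0 g x \in par g false.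
Proof. exact: memv_pi. Qed.

Lemma pi0_odd x : x \in par g true -> pi0 g x = 0.
Proof.
move=> xo; have := daddv_pi_add (par_cap g) (_ : x \in (par g false + par g true)%VS).
rewrite par_sum => /(_ (memvf x)) xE; rewrite -[in RHS](subrr x) -[X in X - x]xE.
by rewrite [daddv_pi (par g true) _ x]daddv_pi_id ?addrK // capvC par_cap.
Qed.

Definition pim : 'End(g) :=
  (daddv_pi (gm g) (gp g) \o daddv_pi (par g true) (par g false))%VF.
Definition pip : 'End(g) :=
  (daddv_pi (gp g) (gm g) \o daddv_pi (par g true) (par g false))%VF.

Lemma pi_sum x : x = pim x + pi0 g x + pip x.
Proof.
rewrite addrAC [pim x]lfunE [pip x]lfunE /= daddv_pi_add ?odd_cap //; last first.
  by rewrite odd_sum memv_pi.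
by rewrite addrC daddv_pi_add ?par_cap // par_sum memvf.
Qed.

Lemma par0_pi_odd x : x \in par g false -> daddv_pi (par g true) (par g false) x = 0.
Proof.
move=> x0; have := daddv_pi_add (par_cap g) (_ : x \in (par g false + par g true)%VS).
rewrite par_sum => /(_ (memvf x)); rewrite daddv_pi_id ?par_cap // => /(canRL (addKr _)).
by rewrite addNr.
Qed.

Lemma pim_g0 x : x \in par g false -> pim x = 0.
Proof. by move=> x0; rewrite lfunE /= par0_pi_odd // linear0. Qed.
Lemma pip_g0 x : x \in par g false -> pip x = 0.
Proof. by move=> x0; rewrite lfunE /= par0_pi_odd // linear0. Qed.

Lemma pi_odd_id x : x \in par g true -> daddv_pi (par g true) (par g false) x = x.
Proof. by apply: daddv_pi_id; rewrite capvC par_cap. Qed.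

Lemma pim_gm x : x \in gm g -> pim x = x.
Proof.
by move=> xm; rewrite lfunE /= pi_odd_id ?gm_odd // daddv_pi_id ?odd_cap.
Qed.
Lemma pip_gp x : x \in gp g -> pip x = x.
Proof.
by move=> xp; rewrite lfunE /= pi_odd_id ?gp_odd // daddv_pi_id // capvC odd_cap.
Qed.
Lemma pim_gp x : x \in gp g -> pim x = 0.
Proof.
move=> xp; have := pi_sum x; rewrite pip_gp // pi0_odd ?gp_odd // addr0.
by rewrite -{1}[x]add0r => /addIr.
Qed.
Lemma pip_gm x : x \in gm g -> pip x = 0.
Proof.
move=> xm; have := pi_sum x; rewrite pim_gm // pi0_odd ?gm_odd // addr0.
by rewrite -{1}[x]addr0 => /addrI.
Qed.

End TypeI.

(** * The action on the exterior algebra *)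

Section ExtOps.
Variables (F : fieldType) (g : typeI F) (d : nat) (X : d.-tuple g).
Variables (M : lmodType F).
Local Notation E := {ffun {set 'I_d} -> M}.
Implicit Types (f : E).

Definition ext_mul (y : g) f : E := \sum_i coord X i y *: create i f.
(** The swapped argument order lets linearity in the element of g be registered as well; [ext_derr],
    [ext_pwr], [ext_evr], [ext_gpr] and [ext_actr] serve the same purpose. *)
Definition ext_mulr f y := ext_mul y f.
(** For [x] in g_0 this is the derivation of the exterior algebra that extends ad x on g_{-1}. *)
Definition ext_der (x : g) f : E := \sum_(j < d) ext_mul (br x X`_j) (annih j f).
Definition ext_derr f x := ext_der x f.

Lemma ext_mul_linear y : linear (ext_mul y).
Proof.
move=> a f f'; rewrite /ext_mul scaler_sumr -big_split; apply: eq_bigr => i _ /=.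
by rewrite linearP scalerDr !scalerA mulrC.
Qed.
HB.instance Definition _ y := GRing.isLinear.Build F E E *:%R
  (ext_mul y) (ext_mul_linear y).

Lemma ext_mulr_linear f : linear (ext_mulr f).
Proof.
move=> a y y'; rewrite /ext_mulr /ext_mul scaler_sumr -big_split; apply: eq_bigr => i _ /=.
by rewrite linearP scalerDl scalerA.
Qed.
HB.instance Definition _ f := GRing.isLinear.Build F g E *:%R
  (ext_mulr f) (ext_mulr_linear f).

Lemma ext_der_linear x : linear (ext_der x).
Proof.
move=> a f f'; rewrite /ext_der scaler_sumr -big_split; apply: eq_bigr => i _ /=.
by rewrite !linearP.
Qed.
HB.instance Definition _ x := GRing.isLinear.Build F E E *:%R
  (ext_der x) (ext_der_linear x).

Lemma ext_derr_linear f : linear (ext_derr f).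
Proof.
move=> a y y'; rewrite /ext_derr /ext_der scaler_sumr -big_split; apply: eq_bigr => i _ /=.
by rewrite br_linear_l -!/(ext_mulr _ _) linearP.
Qed.
HB.instance Definition _ f := GRing.isLinear.Build F g E *:%R
  (ext_derr f) (ext_derr_linear f).

Lemma ext_mulD y : {morph ext_mul y : u v / u + v}. Proof. exact: raddfD. Qed.
Lemma ext_mulN y : {morph ext_mul y : u / - u}. Proof. exact: raddfN. Qed.
Lemma ext_mulDl y z f : ext_mul (y + z) f = ext_mul y f + ext_mul z f.
Proof. exact: (raddfD (ext_mulr f)). Qed.

Lemma annih_mul i y f :
  annih i (ext_mul y f) = coord X i y *: f - ext_mul y (annih i f).
Proof.
rewrite linear_sum /=.
under eq_bigr do rewrite linearZ /= annih_create scalerBr.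
rewrite sumrB (bigD1 i) //= eqxx scale1r big1 ?addr0 // => j.
by rewrite eq_sym => /negbTE->; rewrite scale0r scaler0.
Qed.

Lemma create_mul i y f : create i (ext_mul y f) = - ext_mul y (create i f).
Proof.
rewrite linear_sum [in RHS]/ext_mul -sumrN; apply: eq_bigr => j _.
by rewrite linearZ /= createC scalerN.
Qed.

Lemma ext_mulC y z f : ext_mul y (ext_mul z f) = - ext_mul z (ext_mul y f).
Proof.
rewrite [ext_mul y (ext_mul z f)]/ext_mul [ext_mul y f]/ext_mul (linear_sum (ext_mul z)) -sumrN.
apply: eq_bigr => j _.
by rewrite create_mul linearZ /= scalerN.
Qed.

Hypothesis Xb : basis_of (gm g) X.

Lemma basis_gm i : (i < d)%N -> X`_i \in gm g.
Proof. by move=> ilt; apply: (basis_mem Xb); rewrite mem_nth // size_tuple. Qed.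

Lemma ext_mul_basis (i : 'I_d) f : ext_mul X`_i f = create i f.
Proof.
rewrite /ext_mul (bigD1 i) //= coord_free ?(basis_free Xb) // eqxx scale1r.
rewrite big1 ?addr0 // => j ji.
by rewrite coord_free ?(basis_free Xb) // eq_sym (negbTE ji) scale0r.
Qed.

(** The terms in which [annih j] contracts [y] add up to multiplication by [x,y]. In the others [y]
    passes one annihilation and one multiplication, and the two signs cancel. *)
Lemma ext_der_mul x y f : y \in gm g ->
  ext_der x (ext_mul y f) = ext_mul (br x y) f + ext_mul y (ext_der x f).
Proof.
move=> ym; rewrite /ext_der.
under eq_bigr do rewrite annih_mul linearB linearZ /= ext_mulC opprK.
rewrite big_split /= -linear_sum; congr (_ + _).
rewrite [in RHS](coord_basis Xb ym) linear_sum -/(ext_mulr f _) linear_sum.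
by apply: eq_bigr => i _; rewrite linearZ linearZ.
Qed.

(** Since [X_i,y] = 0, the Jacobi identity gives [[a,X_i],y] = [X_i,[a,y]], and [a,y] is even. *)
Lemma ext_der_anti a i y f : a \in gp g -> y \in gm g -> (i < d)%N ->
  ext_mul (br (br a X`_i) y) f = - ext_mul (br (br a y) X`_i) f.
Proof.
move=> ap ym ilt; rewrite -!/(ext_mulr f _) -linearN; congr ext_mulr.
have Xi := basis_gm ilt.
have := br_jacobi y (gp_odd ap) (gm_odd Xi); rewrite (brmm Xi ym) br0r /= expr1 scaleN1r.
move/esym/eqP; rewrite subr_eq0 => /eqP->.
have ay0 : br a y \in par g false by apply: (br_par (gp_odd ap) (gm_odd ym)).
by rewrite (br_skew (gm_odd Xi) ay0) scale1r.
Qed.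

End ExtOps.

(** * The explicit g-module structure on M (x) Lambda g_{-1} *)

Section ExtModule.
Variables (F : fieldType) (g : typeI F) (d : nat) (X : d.-tuple g).
Variables (M : lmodType F) (act : g -> M -> M).
Local Notation E := {ffun {set 'I_d} -> M}.
Local Notation vac := (monom finset.set0).
Implicit Types (f : E) (x y z a b : g) (m : M).

Definition ext_pw x f : E := [ffun T => kac_act act x (f T)].
Definition ext_ev x f : E := ext_pw x f + ext_der X x f.
(* The coefficient 1/2 is there because [[a,X_i],X_j] and a_j a_i are both
   antisymmetric in i and j: each pair {i, j} occurs twice in the double sum. *)
Definition ext_gp a f : E :=
  \sum_(i < d) (ext_pw (br a X`_i) (annih i f) +
                2^-1 *: ext_der X (br a X`_i) (annih i f)).
Definition ext_act x f : E :=
  ext_mul X (pim g x) f + ext_ev (pi0 g x) f + ext_gp (pip g x) f.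

Variable mp : bool -> set M.
Hypothesis Xb : basis_of (gm g) X.
Hypothesis actM : is_module (par g false) mp act.
Hypothesis F2 : 2%:R != 0 :> F.

Lemma kac_act_linear x : linear (kac_act act x).
Proof. exact: (mod_linear actM) (pi0_mem x). Qed.
HB.instance Definition _ x := GRing.isLinear.Build F M M *:%R
  (kac_act act x) (kac_act_linear x).

Lemma kac_act_linear_l c x y m :
  kac_act act (c *: x + y) m = c *: kac_act act x m + kac_act act y m.
Proof. by rewrite /kac_act linearP (mod_linear_l actM) ?pi0_mem. Qed.

Lemma ext_pw_linear x : linear (ext_pw x).
Proof. by move=> c f f'; apply/ffunP => T; rewrite !ffunE kac_act_linear. Qed.
HB.instance Definition _ x := GRing.isLinear.Build F E E *:%R
  (ext_pw x) (ext_pw_linear x).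

Let ext_pwr f x := ext_pw x f.
Lemma ext_pwr_linear f : linear (ext_pwr f).
Proof. by move=> c x y; apply/ffunP => T; rewrite !ffunE kac_act_linear_l. Qed.
HB.instance Definition _ f := GRing.isLinear.Build F g E *:%R
  (ext_pwr f) (ext_pwr_linear f).

Lemma ext_ev_linear x : linear (ext_ev x).
Proof. by move=> c f f'; rewrite /ext_ev !linearP addrACA scalerDr. Qed.
HB.instance Definition _ x := GRing.isLinear.Build F E E *:%R
  (ext_ev x) (ext_ev_linear x).

Let ext_evr f x := ext_ev x f.
Lemma ext_evr_linear f : linear (ext_evr f).
Proof.
move=> c x y; rewrite /ext_evr /ext_ev -!/(ext_pwr _ _) -!/(ext_derr _ _ _).
by rewrite !linearP addrACA scalerDr.
Qed.
HB.instance Definition _ f := GRing.isLinear.Build F g E *:%R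
  (ext_evr f) (ext_evr_linear f).

Lemma ext_gp_linear a : linear (ext_gp a).
Proof.
move=> c f f'; rewrite /ext_gp scaler_sumr -big_split; apply: eq_bigr => i _ /=.
by rewrite !linearP !scalerDr addrACA !scalerA [c * _]mulrC.
Qed.
HB.instance Definition _ a := GRing.isLinear.Build F E E *:%R
  (ext_gp a) (ext_gp_linear a).

Let ext_gpr f x := ext_gp x f.
Lemma ext_gpr_linear f : linear (ext_gpr f).
Proof.
move=> c x y; rewrite /ext_gpr /ext_gp scaler_sumr -big_split; apply: eq_bigr => i _ /=.
rewrite br_linear_l -!/(ext_pwr _ _) -!/(ext_derr _ _ _) !linearP !scalerDr.
by rewrite addrACA !scalerA [c * _]mulrC.
Qed.
HB.instance Definition _ f := GRing.isLinear.Build F g E *:%R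
  (ext_gpr f) (ext_gpr_linear f).

Lemma ext_evD x : {morph ext_ev x : u v / u + v}. Proof. exact: raddfD. Qed.
Lemma ext_evN x : {morph ext_ev x : u / - u}. Proof. exact: raddfN. Qed.
Lemma ext_evDl x y f : ext_ev (x + y) f = ext_ev x f + ext_ev y f.
Proof. exact: (raddfD (ext_evr f)). Qed.
Lemma ext_gpD x : {morph ext_gp x : u v / u + v}. Proof. exact: raddfD. Qed.
Lemma ext_gpN x : {morph ext_gp x : u / - u}. Proof. exact: raddfN. Qed.

Lemma ext_act_linear x : linear (ext_act x).
Proof.
exact: (linearP (ext_mul X (pim g x) \+ ext_ev (pi0 g x) \+ ext_gp (pip g x))).
Qed.
HB.instance Definition _ x := GRing.isLinear.Build F E E *:%R
  (ext_act x) (ext_act_linear x).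

Let ext_actr f x := ext_act x f.
Lemma ext_actr_linear f : linear (ext_actr f).
Proof.
exact: (linearP ((ext_mulr X f \o pim g) \+ (ext_evr f \o pi0 g) \+ (ext_gpr f \o pip g))).
Qed.
HB.instance Definition _ f := GRing.isLinear.Build F g E *:%R
  (ext_actr f) (ext_actr_linear f).

Lemma ext_pw_create x i f : ext_pw x (create i f) = create i (ext_pw x f).
Proof.
apply/ffunP => T; rewrite !ffunE; case: ifP => _; last exact: linear0.
by rewrite linearZ.
Qed.

Lemma ext_pw_mul x y f : ext_pw x (ext_mul X y f) = ext_mul X y (ext_pw x f).
Proof.
rewrite linear_sum; apply: eq_bigr => i _.
by rewrite linearZ /= ext_pw_create.
Qed.

Lemma ext_ev_mul x y f : y \in gm g ->
  ext_ev x (ext_mul X y f) = ext_mul X (br x y) f + ext_mul X y (ext_ev x f).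
Proof.
by move=> ym; rewrite /ext_ev ext_pw_mul ext_der_mul // linearD addrCA.
Qed.

(** Contracting [y] with the [annih i] yields the action of [a,y] on M but only half of its
    derivation term. The other half arises when [y] passes [ext_der]: this leaves multiplication by
    [[a,X_i],y], which [ext_der_anti] turns into -[[a,y],X_i]. *)
Lemma ext_gp_mul a y f : a \in gp g -> y \in gm g ->
  ext_gp a (ext_mul X y f) = ext_ev (br a y) f - ext_mul X y (ext_gp a f).
Proof.
move=> ap ym; rewrite /ext_gp (linear_sum (ext_mul X y)) /=.
have -> : ext_ev (br a y) f = \sum_(i < d) (coord X i y *: ext_ev (br a X`_i) f).
  rewrite {1}(coord_basis Xb ym) linear_sum -/(ext_evr _ _) linear_sum.
  by apply: eq_bigr => i _; rewrite !linearZ.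
have -> : \sum_(i < d) coord X i y *: ext_ev (br a X`_i) f =
   \sum_(i < d) coord X i y *: (ext_pw (br a X`_i) f + 2^-1 *: ext_der X (br a X`_i) f)
   + 2^-1 *: ext_der X (br a y) f.
  have -> : ext_der X (br a y) f = \sum_(i < d) (coord X i y *: ext_der X (br a X`_i) f).
    rewrite {1}(coord_basis Xb ym) linear_sum -/(ext_derr _ _ _) linear_sum.
    by apply: eq_bigr => i _; rewrite !linearZ.
  rewrite scaler_sumr -big_split; apply: eq_bigr => i _ /=.
  rewrite /ext_ev scalerA mulrC -scalerA -scalerDr -addrA -scalerDl.
  by rewrite -[2^-1]mul1r -mulrDl divff // scale1r.
rewrite [ext_der X (br a y) f]/ext_der scaler_sumr -big_split -sumrB.
apply: eq_bigr => i _ /=.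
rewrite annih_mul !linearB !linearZ /= ext_pw_mul ext_der_mul // ext_der_anti //.
rewrite opprD opprK scalerBr scalerDr (linearD (ext_mul X y)) /=.
rewrite [ext_mul X y (_ *: _)]linearZ /= opprD.
by rewrite !addrA (ACl (1*3*4*2*5)).
Qed.

Lemma ext_ev_vac x m : ext_ev x (vac m) = vac (kac_act act x m).
Proof.
rewrite /ext_ev /ext_der big1 ?addr0 => [|i _]; last by rewrite annih_vac linear0.
apply/ffunP => T; rewrite !ffunE; case: ifP => // _.
exact: linear0.
Qed.

Lemma ext_gp_vac x m : ext_gp x (vac m) = 0.
Proof.
by rewrite /ext_gp big1 // => i _; rewrite annih_vac !linear0 ?scaler0 addr0.
Qed.

(** On the vacuum this is the bracket axiom of M. Past a creation operator, both sides pick up the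
    same extra terms by the Jacobi identity for x, y, X_i. *)
Lemma ext_ev_ev x y f : x \in par g false -> y \in par g false ->
  ext_ev x (ext_ev y f) = ext_ev (br x y) f + ext_ev y (ext_ev x f).
Proof.
move=> x0 y0; elim/monom_ind: f => [c u v IHu IHv|m|i f IH].
- by rewrite !(ext_gp_linear, ext_ev_linear) IHu IHv [RHS]addrACA -scalerDr.
- rewrite !ext_ev_vac -linearD; congr (vac _).
  rewrite /kac_act !pi0_id ?(br_par x0 y0) //.
  by rewrite (mod_br actM _ x0 y0 x0 y0) scale1r subrK.
have zm := basis_gm Xb (ltn_ord i).
rewrite -(ext_mul_basis Xb) !ext_ev_mul // !ext_evD !ext_ev_mul ?br0m // IH.
rewrite (br_jacobi _ x0 y0) scale1r ext_mulDl ext_mulD.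
have ac (p q r s u v : E) :
    p + q + r + (s + (u + v)) = p + u + (q + s + (r + v)).
  by rewrite !addrA (ACl (1*5*2*4*3*6)).
exact: ac.
Qed.

(** Both sides kill the vacuum. Carrying them past X_i leaves a relation between the even elements x
    and [a,X_i], which is [ext_ev_ev]. *)
Lemma ext_ev_gp x a f : x \in par g false -> a \in gp g ->
  ext_ev x (ext_gp a f) = ext_gp (br x a) f + ext_gp a (ext_ev x f).
Proof.
move=> x0 ap; elim/monom_ind: f => [c u v IHu IHv|m|i f IH].
- by rewrite !(ext_gp_linear, ext_ev_linear) IHu IHv [RHS]addrACA -scalerDr.
- by rewrite !(ext_gp_vac, ext_ev_vac) linear0 addr0.
have zm := basis_gm Xb (ltn_ord i).
have az0 : br a X`_i \in par g false by apply: (br_par (gp_odd ap) (gm_odd zm)).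
rewrite -(ext_mul_basis Xb) (ext_gp_mul _ ap zm) (ext_gp_mul _ (br0p x0 ap) zm).
rewrite (ext_ev_mul x _ zm) ext_evD ext_evN (ext_ev_ev _ x0 az0) (ext_ev_mul _ _ zm).
rewrite ext_gpD (ext_gp_mul _ ap (br0m x0 zm)) (ext_gp_mul _ ap zm) IH.
rewrite (br_jacobi _ x0 (gp_odd ap)) scale1r ext_evDl ext_mulD.
have ac (p q r s u v : E) :
    p + q + r - (s + (u + v)) = p - u + (q - s + (r - v)).
  by rewrite !opprD !addrA (ACl (1*5*2*4*3*6)).
exact: ac.
Qed.

(** Again everything vanishes on the vacuum. Past X_i the cross terms are handled by [ext_ev_gp],
    and they cancel because [a,b] = 0 forces [a,[b,X_i]] = -[b,[a,X_i]]. *)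
Lemma ext_gp_gp a b f : a \in gp g -> b \in gp g ->
  ext_gp a (ext_gp b f) = - ext_gp b (ext_gp a f).
Proof.
move=> ap bp; elim/monom_ind: f => [c u v IHu IHv|m|i f IH].
- by rewrite !ext_gp_linear IHu IHv opprD scalerN.
- by rewrite !ext_gp_vac !linear0.
have zm := basis_gm Xb (ltn_ord i).
have az0 : br a X`_i \in par g false by apply: (br_par (gp_odd ap) (gm_odd zm)).
have bz0 : br b X`_i \in par g false by apply: (br_par (gp_odd bp) (gm_odd zm)).
rewrite -(ext_mul_basis Xb) (ext_gp_mul _ ap zm) (ext_gp_mul _ bp zm).
rewrite !(ext_gpD _ (ext_ev _ _) (- _)) !ext_gpN (ext_gp_mul _ ap zm) (ext_gp_mul _ bp zm).
rewrite (ext_ev_gp _ az0 bp) (ext_ev_gp _ bz0 ap) IH ext_mulN.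
have := br_jacobi X`_i (gp_odd ap) (gp_odd bp).
rewrite (brpp ap bp) br0l add0r /= expr1 scaleN1r.
rewrite (br_skew az0 (gp_odd bp)) (br_skew bz0 (gp_odd ap)) !scale1r => ->; rewrite !opprK.
rewrite -[ext_gp (- _) f]/(ext_gpr f _) raddfN /ext_gpr /=.
have ac (p q r s : E) : p - (- q + r + s) = - (r - (q + p - s)).
  by rewrite !opprD !opprK !addrA (ACl (3*2*1*4)).
exact: ac.
Qed.

Lemma ext_act_gm y f : y \in gm g -> ext_act y f = ext_mul X y f.
Proof.
move=> ym; rewrite /ext_act pim_gm // pi0_odd ?gm_odd // pip_gm //.
by rewrite -[ext_ev 0 f]/(ext_evr f 0) -[ext_gp 0 f]/(ext_gpr f 0) !linear0 !addr0.
Qed.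

Lemma ext_act_g0 x f : x \in par g false -> ext_act x f = ext_ev x f.
Proof.
move=> x0; rewrite /ext_act pim_g0 // pi0_id // pip_g0 //.
rewrite -[ext_mul X 0 f]/(ext_mulr X f 0) -[ext_gp 0 f]/(ext_gpr f 0).
by rewrite !linear0 add0r addr0.
Qed.

Lemma ext_act_gp a f : a \in gp g -> ext_act a f = ext_gp a f.
Proof.
move=> ap; rewrite /ext_act pim_gp // pi0_odd ?gp_odd // pip_gp //.
by rewrite -[ext_ev 0 f]/(ext_evr f 0) -[ext_mul X 0 f]/(ext_mulr X f 0) !linear0 !add0r.
Qed.

Lemma odd_split x : x \in par g true ->
  exists a b, [/\ a \in gm g, b \in gp g & x = a + b].
Proof. by rewrite -odd_sum => /memv_addP[a am [b bp ->]]; exists a, b. Qed.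

Lemma ext_actD x : {morph ext_act x : u v / u + v}. Proof. exact: raddfD. Qed.
Lemma ext_actDl x y f : ext_act (x + y) f = ext_act x f + ext_act y f.
Proof. exact: (raddfD (ext_actr f)). Qed.

(** The sign [s] is kept apart from the parities, so that the relation is additive in [x] and in [y]
    and can be assembled from the graded pieces. *)
Let super_comm (s : F) x y := forall f,
  ext_act (br x y) f = ext_act x (ext_act y f) - s *: ext_act y (ext_act x f).

Let super_commDl s x x' y :
  super_comm s x y -> super_comm s x' y -> super_comm s (x + x') y.
Proof.
move=> xy x'y f; rewrite -[br _ y]/(brr y _) raddfD !ext_actDl /= xy x'y.
rewrite (ext_actD y (ext_act x f) (ext_act x' f)).
have ac (p q u v : E) : p - s *: q + (u - s *: v) = p + u - s *: (q + v).
  by rewrite scalerDr opprD addrACA.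
exact: ac.
Qed.

Let super_commDr s x y y' :
  super_comm s x y -> super_comm s x y' -> super_comm s x (y + y').
Proof.
move=> xy xy' f; rewrite (raddfD (br x)) !ext_actDl /= xy xy'.
rewrite (ext_actD x (ext_act y f) (ext_act y' f)).
have ac (p q u v : E) : p - s *: q + (u - s *: v) = p + u - s *: (q + v).
  by rewrite scalerDr opprD addrACA.
exact: ac.
Qed.

Let super_comm_sym s x y : s * s = 1 -> br y x = - (s *: br x y) ->
  super_comm s x y -> super_comm s y x.
Proof.
move=> ss yx xy f; rewrite yx -scaleNr -[ext_act (_ *: _) f]/(ext_actr f _).
rewrite linearZ /= /ext_actr xy scalerBr scalerA mulNr ss scaleN1r opprK addrC.
by rewrite scaleNr.
Qed.

(** Odd elements are split into their g_{-1} and g_1 components. Each resulting pair is one of the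
    commutation rules above, possibly in reversed order, which [super_comm_sym] allows. *)
Lemma ext_act_br i j x y f : x \in par g i -> y \in par g j ->
  ext_act (br x y) f =
  ext_act x (ext_act y f) - (-1) ^+ (i && j) *: ext_act y (ext_act x f).
Proof.
have even_odd x' y' : x' \in par g false -> y' \in par g true -> super_comm 1 x' y'.
  move=> x0 /odd_split[a [b [am bp ->]]]; apply: super_commDr => f'; rewrite scale1r.
    rewrite !(ext_act_gm _ am) (ext_act_gm _ (br0m x0 am)) !(ext_act_g0 _ x0).
    by rewrite ext_ev_mul // addrK.
  rewrite !(ext_act_gp _ bp) (ext_act_gp _ (br0p x0 bp)) !(ext_act_g0 _ x0).
  by rewrite ext_ev_gp // addrK.
have gp_gm a b : b \in gp g -> a \in gm g -> super_comm (-1) b a.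
  move=> bp am f'; rewrite scaleN1r opprK.
  rewrite ext_act_g0 ?(br_par (gp_odd bp) (gm_odd am)) // !(ext_act_gm _ am).
  by rewrite !(ext_act_gp _ bp) ext_gp_mul // subrK.
move=> xi yj; suff: super_comm ((-1) ^+ (i && j)) x y by [].
case: i xi; case: j yj => yj xi; rewrite /= ?(expr1, expr0).
- have [a [b [am bp ->]]] := odd_split xi; have [a' [b' [am' bp' ->]]] := odd_split yj.
  apply: super_commDl; apply: super_commDr.
  + move=> f'; rewrite (brmm am am') scaleN1r opprK (ext_act_gm _ (mem0v _)).
    rewrite !(ext_act_gm _ am) !(ext_act_gm _ am') (ext_mulC X a) addNr.
    exact: (linear0 (ext_mulr X f')).
  + apply: super_comm_sym (gp_gm _ _ bp' am); first by rewrite mulrNN mulr1.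
    by rewrite (br_skew (gm_odd am) (gp_odd bp')) /= expr1.
  + exact: gp_gm.
  move=> f'; rewrite (brpp bp bp') scaleN1r opprK (ext_act_gp _ (mem0v _)).
  rewrite !(ext_act_gp _ bp) !(ext_act_gp _ bp') (ext_gp_gp _ bp bp') addNr.
  exact: (linear0 (ext_gpr f')).
- apply: super_comm_sym (even_odd _ _ yj xi); rewrite ?mulr1 //.
  by rewrite (br_skew xi yj) !scale1r.
- exact: even_odd.
by move=> f'; rewrite scale1r !ext_act_g0 ?(br_par xi yj) // ext_ev_ev // addrK.
Qed.

(** This is the balancing relation of the induced module, satisfied by the vacuum vectors. *)
Lemma ext_act_vac x m : x \in (par g false + gp g)%VS ->
  ext_act x (vac m) = vac (kac_act act x m).
Proof.
case/memv_addP=> y y0 [a ap ->]; rewrite ext_actDl ext_act_g0 // ext_act_gp //.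
rewrite ext_ev_vac ext_gp_vac addr0; congr (vac _).
by rewrite /kac_act raddfD /= (pi0_odd (gp_odd ap)) addr0.
Qed.

End ExtModule.

(** * Induced modules *)

Section InducedModule.
Variables (F : fieldType) (g : lieSuper F) (p : {vspace g}).
Variables (M : lmodType F) (act : g -> M -> M).
Local Notation Ind := (Ind p act).
Local Notation ind_word := (ind_word p act).
Local Notation ind_act := (@ind_act F g p M act).

Lemma lpi_rel u v : ind_rel p act (u - v) -> lpi (ind_rel p act) u = lpi (ind_rel p act) v.
Proof. by move=> r; apply: lquot_eq => P _; apply. Qed.

Lemma ind_word_linear w : linear (ind_word w).
Proof.
move=> c m m'; rewrite /ind_word -linearP; apply: lpi_rel; exact: RelVector.
Qed.
HB.instance Definition _ w := GRing.isLinear.Build F M Ind *:%R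
  (ind_word w) (ind_word_linear w).
HB.instance Definition _ x := GRing.isLinear.Build F Ind Ind *:%R (ind_act x)
  (@ind_act_linear F g p M act x).

Lemma ind_act0r x : ind_act x 0 = 0. Proof. exact: linear0. Qed.
Lemma ind_actDr x : {morph ind_act x : u v / u + v}. Proof. exact: raddfD. Qed.
Lemma ind_actZr x c q : ind_act x (c *: q) = c *: ind_act x q.
Proof. exact: linearZ. Qed.

(** The words span: a representative in the free module is a finite combination of generators. *)
Lemma ind_ind (P : Ind -> Prop) :
  (forall c u v, P u -> P v -> P (c *: u + v)) ->
  (forall w m, P (ind_word w m)) -> forall q, P q.
Proof.
move=> PD Pw; have P0 : P 0 by have := Pw [::] 0; rewrite linear0.
move=> q; have -> : q = lpi (ind_rel p act) (repr q) by rewrite /lpi reprK.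
move: (repr q) => {}q; rewrite (monalgE q) linear_sum /=.
elim/big_ind: _ => // [u v Pu Pv|[w m] _]; first by rewrite -[u]scale1r; apply: PD.
have -> : << q@_(w, m) *g (w, m) >> = q@_(w, m) *: gen w m :> ind_free g M.
  by apply/malgP => k; rewrite mcoeffZ !mcoeffU mulrnAr mulr1.
rewrite linearZ /= -[_ *: _]addr0; apply: PD (Pw w m) P0.
Qed.

Lemma ind_act_linear_l c x y q : ind_act (c *: x + y) q = c *: ind_act x q + ind_act y q.
Proof.
elim/ind_ind: q => [a u v IHu IHv|w m].
  rewrite !ind_act_linear IHu IHv.
  have ac (V : lmodType F) (r s t z : V) :
      a *: (c *: r + s) + (c *: t + z) = c *: (a *: r + t) + (a *: s + z).
    by rewrite !scalerDr addrACA !scalerA mulrC.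
  exact: ac.
rewrite !ind_act_word -lpi_linear; apply: lpi_rel; exact: (RelLetter _ _ [::]).
Qed.

Lemma ind_act_br i j x y q : x \in par g i -> y \in par g j ->
  ind_act (br x y) q =
  ind_act x (ind_act y q) - (-1) ^+ (i && j) *: ind_act y (ind_act x q).
Proof.
move=> xi yj; elim/ind_ind: q => [a u v IHu IHv|w m].
  rewrite !ind_act_linear IHu IHv.
  have ac (V : lmodType F) (s : F) (r t z v' : V) :
      a *: (r - s *: t) + (z - s *: v') = a *: r + z - s *: (a *: t + v').
    by rewrite !scalerDr opprD addrACA scalerN !scalerA mulrC.
  exact: ac.
rewrite !ind_act_word /ind_word.
by rewrite -(lpi_rel (RelBracket p act [::] w m xi yj)) linearB linearZ.
Qed.

Lemma ind_act_balance x m : x \in p -> ind_act x (ind_word [::] m) = ind_word [::] (act x m).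
Proof. by move=> xp; rewrite ind_act_word; apply: lpi_rel; apply: (RelBalance _ [::]). Qed.

End InducedModule.

(** * The comparison map from M (x) Lambda g_{-1} to K(M) *)

Section KacMap.
Variables (F : fieldType) (g : typeI F) (d : nat) (X : d.-tuple g).
Variables (M : lmodType F) (act : g -> M -> M).
Local Notation E := {ffun {set 'I_d} -> M}.
Local Notation kact := (kac_act act).
Local Notation p := (par g false + gp g)%VS.
Implicit Types (f : E) (y z : g) (m : M).

(** This is [kac_iso] for an arbitrary tuple [X]; over H it will be used with a basis transported
    from g. *)
Definition kac_map f : kac act :=
  \sum_(T : {set 'I_d}) ind_word p kact [seq X`_i | i : 'I_d <- enum T] (f T).

Definition kac_word (s : seq 'I_d) m : kac act :=
  ind_word p kact [seq X`_i | i : 'I_d <- s] m.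

Lemma kac_map_linear : linear kac_map.
Proof.
move=> c f f'; rewrite /kac_map scaler_sumr -big_split; apply: eq_bigr => T _.
by rewrite !ffunE linearP.
Qed.
HB.instance Definition _ := GRing.isLinear.Build F E (kac act) *:%R
  kac_map kac_map_linear.

Lemma kac_map_monom T m : kac_map (monom T m) = kac_word (enum T) m.
Proof.
rewrite /kac_map (bigD1 T) //= ffunE eqxx big1 ?addr0 // => U /negbTE UT.
by rewrite ffunE UT linear0.
Qed.

Hypothesis Xb : basis_of (gm g) X.
Hypothesis F2 : 2%:R != 0 :> F.

Let Xgm (i : 'I_d) : X`_i \in gm g := basis_gm Xb (ltn_ord i).

Lemma kac_act0 (q : kac act) : ind_act 0 q = 0.
Proof.
by have := ind_act_linear_l (-1) 0 0 q; rewrite scaler0 addr0 scaleN1r addNr.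
Qed.

Lemma gm_anti y z (q : kac act) : y \in gm g -> z \in gm g ->
  ind_act y (ind_act z q) = - ind_act z (ind_act y q).
Proof.
move=> ym zm; have := ind_act_br q (gm_odd ym) (gm_odd zm).
rewrite (brmm ym zm) kac_act0 /= expr1 scaleN1r opprK => /esym/eqP.
by rewrite addr_eq0 => /eqP.
Qed.

(** Anticommutation of [y] with itself says that twice the square is zero, and 2 is invertible. *)
Lemma gm_sqr y (q : kac act) : y \in gm g -> ind_act y (ind_act y q) = 0.
Proof.
move=> ym; have /eqP := gm_anti q ym ym; rewrite -subr_eq0 opprK -mulr2n -scaler_nat.
by rewrite scaler_eq0 (negbTE F2) => /eqP.
Qed.

(** For [s] increasing and without [i], this is sorted insertion; the length of the first block
    determines the sign. *)
Definition ord_ins (i : 'I_d) (s : seq 'I_d) :=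
  [seq k : 'I_d <- s | (k < i)%N] ++ i :: [seq k : 'I_d <- s | (i < k)%N].

Local Notation lto := (fun i j : 'I_d => (i < j)%N).

(** X_i is moved to the right, with one sign for each smaller letter, until it meets a larger letter
    or another X_i, in which case the word vanishes. *)
Lemma kac_word_ins (i : 'I_d) s m : sorted lto s ->
  kac_word (i :: s) m = if i \in s then 0
    else (-1) ^+ count (fun k : 'I_d => (k < i)%N) s *: kac_word (ord_ins i s) m.
Proof.
have lt_trans : transitive lto by move=> ? ? ?; apply: ltn_trans.
elim: s => [|k s IH] /=; first by rewrite scale1r.
rewrite (path_sortedE lt_trans) => /andP[ks ss].
have kac_cons j t : kac_word (j :: t) m = ind_act X`_j (kac_word t m).
  by rewrite /kac_word /= ind_act_word.
rewrite inE; case: (ltngtP i k) => [ik|ki|/val_inj <-].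
- have iks j : j \in s -> (i < j)%N by move=> /(allP ks); apply: ltn_trans.
  have ins : i \in s = false by apply/negP => /iks; rewrite ltnn.
  rewrite -(inj_eq val_inj) (ltn_eqF ik) ins /ord_ins /= ltnNge (ltnW ik) /= ik.
  have cnt0 : count (fun j : 'I_d => (j < i)%N) s = 0%N.
    apply/eqP; rewrite -leqn0 leqNgt -has_count; apply/hasPn => j /iks /ltnW.
    by rewrite leqNgt.
  have -> : [seq j : 'I_d <- s | (j < i)%N] = [::] by apply: size0nil; rewrite size_filter.
  have /all_filterP-> : all (fun k : 'I_d => (i < k)%N) s by apply/allP => j /iks.
  by rewrite cnt0 scale1r.
- rewrite -(inj_eq val_inj) (gtn_eqF ki) /=.
  have -> : kac_word [:: i, k & s] m = - ind_act X`_k (kac_word (i :: s) m).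
    by rewrite !kac_cons gm_anti.
  rewrite (IH ss); case: (i \in s); first by rewrite ind_act0r oppr0.
  rewrite ind_actZr -kac_cons /ord_ins /= ki (ltnNge i k) (ltnW ki) /=.
  by rewrite add1n exprS mulN1r scaleNr.
by rewrite eqxx /= !kac_cons gm_sqr.
Qed.

Lemma enum_sorted (U : {set 'I_d}) : sorted lto (enum U).
Proof.
have lt_trans : transitive lto by move=> ? ? ?; apply: ltn_trans.
rewrite /enum_mem -enumT; apply: sorted_filter => //.
by have := iota_ltn_sorted 0 d; rewrite -val_enum_ord sorted_map.
Qed.

(** Two strictly increasing lists with the same elements are equal. *)
Lemma enum_setU1_ins (i : 'I_d) (T : {set 'I_d}) : i \notin T ->
  enum (i |: T) = ord_ins i (enum T).
Proof.
move=> iT.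
have lt_trans : transitive lto by move=> ? ? ?; apply: ltn_trans.
apply: (irr_sorted_eq lt_trans); rewrite ?enum_sorted //; first by move=> k; rewrite /= ltnn.
  have ps : pairwise lto (enum T) by rewrite -sorted_pairwise // enum_sorted.
  rewrite sorted_pairwise // /ord_ins pairwise_cat /= !(pairwise_filter _ ps).
  rewrite allrel_consr filter_all /= filter_all !andbT; apply/allrelP => u v.
  by rewrite !mem_filter => /andP[ui _] /andP[iv _]; apply: ltn_trans ui iv.
move=> k; rewrite /ord_ins mem_cat in_cons !(mem_filter _ k (enum T)) !mem_enum in_setU1.
rewrite orbCA -andb_orl -neq_ltn (inj_eq val_inj).
by case: eqVneq.
Qed.

Lemma kac_map0 : kac_map 0 = 0. Proof. exact: linear0. Qed.
Lemma kac_mapD : {morph kac_map : u v / u + v}. Proof. exact: raddfD. Qed.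
Lemma kac_mapZ c : {morph kac_map : u / c *: u}. Proof. exact: linearZ. Qed.

Lemma csgn_count (i : 'I_d) (T : {set 'I_d}) :
  csgn F i T = (-1) ^+ count (fun k : 'I_d => (k < i)%N) (enum T).
Proof.
rewrite /csgn cardE /enum_mem size_filter count_filter; congr (_ ^+ _).
by apply: eq_count => k /=; rewrite !inE andbC.
Qed.

(** On monomials the sign of [create_monom] is the reordering sign of [kac_word_ins], by
    [csgn_count]. *)
Lemma kac_map_create (i : 'I_d) f : kac_map (create i f) = ind_act X`_i (kac_map f).
Proof.
rewrite [f]ffun_monomE; elim/big_ind: _ => [|u v IHu IHv|T _].
- by rewrite linear0 kac_map0 ind_act0r.
- by rewrite (raddfD (create i)) !kac_mapD IHu IHv ind_actDr.
rewrite kac_map_monom /kac_word ind_act_word -/(kac_word (i :: enum T) _).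
rewrite kac_word_ins ?enum_sorted // mem_enum; case: (boolP (i \in T)) => iT.
  have -> : create i (monom T (f T)) = 0.
    apply/ffunP => U; rewrite !ffunE; case: ifP => // iU.
    case: eqP => [UT|]; rewrite ?scaler0 //.
    by rewrite -UT finset.setD11 in iT.
  exact: kac_map0.
by rewrite (create_monom _ iT) kac_mapZ kac_map_monom (enum_setU1_ins iT) csgn_count.
Qed.

Lemma kac_map_mul y f : y \in gm g -> kac_map (ext_mul X y f) = ind_act y (kac_map f).
Proof.
move=> ym; rewrite {2}(coord_basis Xb ym) /ext_mul.
elim/big_rec2: _ => [|i q u _ IH]; first by rewrite kac_map0 kac_act0.
by rewrite kac_mapD kac_mapZ IH kac_map_create ind_act_linear_l.
Qed.

End KacMap.

(** * Subspaces, and gradings of spaces of functions *)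

Lemma subspaceZ (F : fieldType) (V : lmodType F) (P : set V) (c : F) u :
  Defs.subspace P -> P u -> P (c *: u).
Proof. by move=> [P0 PD] Pu; rewrite -[_ *: _]addr0; apply: PD. Qed.

Lemma subspaceD (F : fieldType) (V : lmodType F) (P : set V) u v :
  Defs.subspace P -> P u -> P v -> P (u + v).
Proof. by move=> [P0 PD] Pu Pv; rewrite -[u]scale1r; apply: PD. Qed.

Lemma subspace_sum (F : fieldType) (V : lmodType F) (P : set V) (I : Type)
    (r : seq I) (G : I -> V) :
  Defs.subspace P -> (forall i, P (G i)) -> P (\sum_(i <- r) G i).
Proof.
by move=> sP PG; elim/big_ind: _ => // [|u v]; [case: sP | apply: subspaceD].
Qed.

(** Here [e i] is the parity of the basis vector indexed by [i]: where it is odd, the two components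
    of a value change places. *)
Lemma ffun_superspace (F : fieldType) (V : lmodType F) (vp : bool -> set V)
    (I : finType) (e : I -> bool) : superspace vp ->
  superspace (fun b => [set f : {ffun I -> V} | forall i, vp (b (+) e i) (f i)]).
Proof.
move=> [vpS vpU]; have vpP b := vpS b; split=> [b|v].
  split=> [i|c u w ub wb i]; rewrite !ffunE; first by case: (vpP (b (+) e i)).
  by apply: (vpP _).2.
have [w wP] := choice vpU.
exists ([ffun i => if e i then (w (v i)).2 else (w (v i)).1],
        [ffun i => if e i then (w (v i)).1 else (w (v i)).2]); split=> /=.
  split=> [i|i|].
  - by rewrite ffunE; have [[w1 w2 _] _] := wP (v i); case: (e i).
  - by rewrite ffunE; have [[w1 w2 _] _] := wP (v i); case: (e i).
  apply/ffunP => i; rewrite !ffunE; have [[_ _ vE] _] := wP (v i).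
  by case: (e i) => //; rewrite addrC.
move=> [u0 u1] /= [u0P u1P vE].
have wE i : w (v i) = if e i then (u1 i, u0 i) else (u0 i, u1 i).
  have [_ uniq_w] := wP (v i); apply: uniq_w; rewrite vE ffunE.
  have := u0P i; have := u1P i; case: (e i) => //= h1 h0; split=> //.
  by rewrite addrC.
by congr (_, _); apply/ffunP => i; rewrite ffunE wE; case: (e i).
Qed.

(** * The isomorphism with the Kac module *)

Section KacIso.
Variables (F : fieldType) (g : typeI F) (d : nat) (X : d.-tuple g).
Variables (M : lmodType F) (act : g -> M -> M).
Variable mp : bool -> set M.
Hypothesis Xb : basis_of (gm g) X.
Hypothesis actM : is_module (par g false) mp act.
Hypothesis F2 : 2%:R != 0 :> F.
Local Notation E := {ffun {set 'I_d} -> M}.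
Local Notation vac := (monom finset.set0).
Local Notation kact := (kac_act act).
Local Notation p := (par g false + gp g)%VS.
Local Notation ext_act := (ext_act X act).
Local Notation kac_map := (@kac_map F g d X M act).
Implicit Types (f : E) (x y : g) (m : M).

Let actDl x y f : ext_act (x + y) f = ext_act x f + ext_act y f := ext_actDl X actM x y f.
Let actP x : linear (ext_act x). Proof. exact: (ext_act_linear X actM). Qed.

Let mapD : {morph kac_map : u v / u + v} := @kac_mapD _ _ _ X _ act.
Let mapP : linear kac_map := @kac_map_linear _ _ _ X _ act.

Let act_create (i : 'I_d) f : ext_act X`_i f = create i f.
Proof. by rewrite (ext_act_gm _ actM) ?basis_gm // ext_mul_basis. Qed.

Lemma kac_map_vac m : kac_map (vac m) = ind_word p kact [::] m.
Proof. by rewrite kac_map_monom /kac_word enum_set0. Qed.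

Let kac_map_act_par i x f : x \in par g i -> kac_map (ext_act x f) = ind_act x (kac_map f).
Proof.
(* [i] and [x] stay general, since passing [X_k] calls the induction hypothesis for [x,X_k] as well
   as for [x]. *)
elim/monom_ind: f i x => [c u v IHu IHv i x xi|m i x xi|k f IH i x xi].
- rewrite actP (mapP c (ext_act x u)) (IHu _ _ xi) (IHv _ _ xi).
  by rewrite (mapP c u) ind_actDr ind_actZr.
- have vac_p y : y \in p -> kac_map (ext_act y (vac m)) = ind_act y (kac_map (vac m)).
    by move=> yp; rewrite (ext_act_vac _ actM) // !kac_map_vac ind_act_balance.
  case: i xi => xi; last by apply: vac_p; apply: (subvP (addvSl _ _)).
  have [a [b [am bp ->]]] := odd_split xi.
  rewrite actDl (mapD (ext_act a _)) (ext_act_gm _ actM _ am) (kac_map_mul _ Xb F2) //.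
  rewrite (vac_p b) ?(subvP (addvSr _ _) _ bp) //.
  by rewrite -[a in RHS]scale1r ind_act_linear_l scale1r.
have zm := basis_gm Xb (ltn_ord k).
have zo := gm_odd zm.
have E1 := ext_act_br Xb actM F2 f xi zo.
have E2 := ind_act_br (kac_map f) xi zo.
have {E1} -> : ext_act x (create k f) =
    (-1) ^+ (i && true) *: ext_act X`_k (ext_act x f) + ext_act (br x X`_k) f.
  by rewrite E1 addrC subrK act_create.
rewrite (mapD (_ *: ext_act _ _)) kac_mapZ (IH _ _ (br_par xi zo)) E2 (ext_act_gm _ actM _ zm).
rewrite (kac_map_mul _ Xb F2 _ zm) (IH _ _ xi) (kac_map_create _ Xb F2).
by rewrite addrC subrK.
Qed.

Lemma kac_map_act x f : kac_map (ext_act x f) = ind_act x (kac_map f).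
Proof.
have /memv_addP[y y0 [z z1 ->]] : x \in (par g false + par g true)%VS.
  by rewrite par_sum memvf.
rewrite actDl (mapD (ext_act y f)) (kac_map_act_par _ y0) (kac_map_act_par _ z1).
by rewrite -[y in RHS]scale1r ind_act_linear_l scale1r.
Qed.

Definition ext_word (w : seq g) (f : E) : E := foldr ext_act f w.

Lemma ext_word_linear w : linear (ext_word w).
Proof. by elim: w => [|x w IH] c u v //=; rewrite IH actP. Qed.

(** The candidate inverse of [kac_map], before passing to the quotient: a word is evaluated letter
    by letter on the vacuum vector. *)
Definition kac_inv_free (q : ind_free g M) : E :=
  \sum_(k <- msupp q) q@_k *: ext_word k.1 (vac k.2).

Lemma kac_inv_free_sub q (D : {fset ind_gen g M}) : (msupp q `<=` D)%fset ->
  kac_inv_free q = \sum_(k <- D) q@_k *: ext_word k.1 (vac k.2).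
Proof.
move=> qd; rewrite /kac_inv_free (big_fset_incl _ qd) // => k _ kq.
by rewrite mcoeff_outdom // scale0r.
Qed.

Lemma kac_inv_free_linear : linear kac_inv_free.
Proof.
move=> a q r; pose D := (msupp q `|` msupp r `|` msupp (a *: q + r))%fset.
rewrite !(@kac_inv_free_sub _ D) ?fsubsetUr //; last first.
- by rewrite /D -fsetUA fsubsetUl.
- by rewrite /D fsetUAC fsubsetUr.
rewrite scaler_sumr -big_split; apply: eq_bigr => k _ /=.
by rewrite mcoeffD mcoeffZ scalerDl scalerA.
Qed.
HB.instance Definition _ := GRing.isLinear.Build F (ind_free g M) E *:%R
  kac_inv_free kac_inv_free_linear.

Lemma kac_inv_free_gen w m : kac_inv_free (gen w m) = ext_word w (vac m).
Proof.
rewrite (@kac_inv_free_sub _ [fset ((w, m) : ind_gen g M)]%fset) ?msuppU_le //.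
by rewrite big_seq_fset1 mcoeffUU scale1r.
Qed.

Lemma ext_word_cat w w' f : ext_word (w ++ w') f = ext_word w (ext_word w' f).
Proof. exact: foldr_cat. Qed.

(** The four families of relations hold in the explicit module by linearity in the letter, linearity
    in the vector, [ext_act_br] and [ext_act_vac] respectively. *)
Lemma kac_inv_free_rel q : ind_rel p kact q -> kac_inv_free q = 0.
Proof.
have fB u v : kac_inv_free (u - v) = kac_inv_free u - kac_inv_free v by exact: linearB.
have fD u v : kac_inv_free (u + v) = kac_inv_free u + kac_inv_free v by exact: linearD.
have fZ (a : F) u : kac_inv_free (a *: u) = a *: kac_inv_free u by exact: linearZ.
case=> [w w' a y z m|w a m m'|w w' i j y z m yi zj|w y m yp].
- rewrite fB fD fZ !kac_inv_free_gen !ext_word_cat -ext_word_linear; apply/eqP.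
  rewrite subr_eq0; apply/eqP; congr ext_word => /=.
  by rewrite (ext_actr_linear X actM).
- rewrite fB fD fZ !kac_inv_free_gen -ext_word_linear -monom_linear.
  by rewrite subrr.
- rewrite !fB fZ !kac_inv_free_gen !ext_word_cat /=.
  rewrite (ext_act_br Xb actM F2 _ yi zj).
  have wB c u v : ext_word w (u - c *: v) = ext_word w u - c *: ext_word w v.
    by rewrite addrC -scaleNr ext_word_linear scaleNr addrC.
  by rewrite wB subrr.
rewrite fB !kac_inv_free_gen -cats1 ext_word_cat /= (ext_act_vac _ actM) //.
by rewrite subrr.
Qed.

Definition kac_inv (q : kac act) : E := kac_inv_free (repr q).

(** Independence of the representative: the kernel of [kac_inv_free] is a subspace containing the
    relations, hence also their span. *)
Lemma kac_inv_pi q : kac_inv (lpi (ind_rel p kact) q) = kac_inv_free q.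
Proof.
apply/eqP; rewrite -subr_eq0 /kac_inv -linearB; apply/eqP.
have : lspan (ind_rel p kact) (repr (lpi (ind_rel p kact) q) - q).
  by apply: lquot_eqP; rewrite reprK.
move=> /(_ [set q | kac_inv_free q = 0]); apply; last by move=> r /kac_inv_free_rel.
split=> [|c u v /= u0 v0]; first exact: linear0.
by rewrite kac_inv_free_linear u0 v0 scaler0 addr0.
Qed.

Lemma kac_inv_word w m : kac_inv (ind_word p kact w m) = ext_word w (vac m).
Proof. by rewrite /ind_word kac_inv_pi kac_inv_free_gen. Qed.

Lemma kac_inv_linear : linear kac_inv.
Proof.
have piE q : q = lpi (ind_rel p kact) (repr q) by rewrite /lpi reprK.
by move=> c u v; rewrite (piE u) (piE v) -lpi_linear !kac_inv_pi kac_inv_free_linear.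
Qed.

Lemma kac_inv_act x q : kac_inv (ind_act x q) = ext_act x (kac_inv q).
Proof.
elim/ind_ind: q => [c u v IHu IHv|w m]; last by rewrite ind_act_word !kac_inv_word.
by rewrite ind_act_linear !kac_inv_linear IHu IHv actP.
Qed.

(** This is the independence half of PBW for K(M): [kac_map] and [kac_inv] match the vacuum vectors
    with the empty words, and [create i] with the action of X_i. *)
Lemma kac_mapK : cancel kac_map kac_inv.
Proof.
move=> f; elim/monom_ind: f => [c u v IHu IHv|m|i f IH].
- by rewrite mapP kac_inv_linear IHu IHv.
- by rewrite kac_map_vac kac_inv_word.
by rewrite (kac_map_create _ Xb F2) kac_inv_act IH act_create.
Qed.

Lemma kac_invK : cancel kac_inv kac_map.
Proof.
elim/ind_ind => [c u v IHu IHv|w m]; first by rewrite kac_inv_linear mapP IHu IHv.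
rewrite kac_inv_word; elim: w => [|x w IH] /=; first exact: kac_map_vac.
by rewrite kac_map_act IH ind_act_word.
Qed.

Lemma kac_map_bij : bijective kac_map.
Proof. exact: Bijective kac_mapK kac_invK. Qed.

Definition fin_par (b : bool) : set E :=
  [set f : E | forall T : {set 'I_d}, mp (b (+) odd #|T|) (f T)].

Let mpP b : Defs.subspace (mp b) := (mod_superspace actM).1 b.

Lemma fin_par_subspace b : Defs.subspace (fin_par b).
Proof.
split=> [T|c u v ub vb T]; rewrite ffunE; first by case: (mpP (b (+) odd #|T|)).
by rewrite ffunE; apply: (mpP _).2.
Qed.

Lemma fin_par_create b i f : fin_par b f -> fin_par (~~ b) (create i f).
Proof.
move=> fb T; rewrite ffunE; case: ifP => iT; last by case: (mpP (~~ b (+) odd #|T|)).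
apply: subspaceZ => //; have := fb (T :\ i); rewrite (cardsD1 i T) iT add1n /=.
by rewrite addNb addbN negbK.
Qed.

Lemma fin_par_annih b i f : fin_par b f -> fin_par (~~ b) (annih i f).
Proof.
move=> fb T; rewrite ffunE; case: ifP => iT; first by case: (mpP (~~ b (+) odd #|T|)).
apply: subspaceZ => //; have := fb (i |: T); rewrite cardsU1 iT add1n /=.
by rewrite addNb addbN.
Qed.

Lemma fin_par_mul b y f : fin_par b f -> fin_par (~~ b) (ext_mul X y f).
Proof.
move=> fb; apply: subspace_sum => [|i]; first exact: fin_par_subspace.
exact: (subspaceZ _ (fin_par_subspace _) (fin_par_create i fb)).
Qed.

Lemma fin_par_der b y f : fin_par b f -> fin_par b (ext_der X y f).
Proof.
move=> fb; apply: subspace_sum => [|i]; first exact: fin_par_subspace.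
by rewrite -[b]negbK; apply: fin_par_mul; apply: fin_par_annih.
Qed.

Lemma fin_par_pw b y f : fin_par b f -> fin_par b (ext_pw act y f).
Proof.
move=> fb T; rewrite ffunE.
exact: (mod_par actM (pi0_mem y) (pi0_mem y) (fb T)).
Qed.

Lemma fin_par_act i j x f : x \in par g i -> fin_par j f ->
  fin_par (i (+) j) (ext_act x f).
Proof.
move=> xi fj; have sP := fin_par_subspace.
case: i xi => [/odd_split[a [b [am bp ->]]]|x0] /=; last first.
  rewrite (ext_act_g0 X actM _ x0).
  exact: (subspaceD (sP _) (fin_par_pw x fj) (fin_par_der x fj)).
rewrite actDl (ext_act_gm X actM _ am) (ext_act_gp X actM _ bp).
apply: (subspaceD (sP _) (fin_par_mul a fj)); apply: (subspace_sum _ (sP _)) => k.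
have fk := fin_par_annih k fj.
exact: (subspaceD (sP _) (fin_par_pw _ fk) (subspaceZ _ (sP _) (fin_par_der _ fk))).
Qed.

Lemma fin_par_vac c m : mp c m -> fin_par c (vac m).
Proof.
move=> mc T; rewrite ffunE; case: eqP => [->|_]; first by rewrite cards0 addbF.
by case: (mpP (c (+) odd #|T|)).
Qed.

(** Forward, the summand at [T] is a word of #|T| odd letters on a vector of parity
    [b (+) odd #|T|]. Backward, the elements whose image under [kac_inv] has parity [b] form a
    subspace containing the homogeneous words. *)
Lemma fin_parP b f : fin_par b f <-> ind_par (p := p) (act := kact) mp b (kac_map f).
Proof.
split=> [fb|].
  have lsP := lspan_subspace; apply: (subspace_sum _ (lsP _ _ _)) => T P sP; apply=> /=.
  exists [seq X`_i | i : 'I_d <- enum T], (nseq (size (enum T)) true).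
  exists (b (+) odd #|T|), (f T).
  split=> //; first by elim: (enum T) => //= k s ->; rewrite gm_odd ?basis_gm.
  have foldr_nseq c n : foldr addb c (nseq n true) = c (+) odd n.
    by elim: n => [|n IH] /=; rewrite ?addbF // IH addbN.
  by rewrite foldr_nseq -cardE -addbA addbb addbF.
move=> /(_ [set q | fin_par b (kac_inv q)]) H.
rewrite -(kac_mapK f); apply: H => [|q [w [e [c [m [we mc <- ->]]]]]] /=.
  have [s0 sD] := fin_par_subspace b.
  split=> [|a u v ub vb] /=; last by rewrite kac_inv_linear; apply: sD.
  by rewrite -[0](kac_map0 X act) kac_mapK.
rewrite kac_inv_word; elim: w e we => [|x w IH] [|i e] //=.
  by move=> _; apply: fin_par_vac.
by case/andP=> xi /IH; apply: fin_par_act.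
Qed.

Lemma ext_act_module : is_module (g := g) fullv fin_par ext_act.
Proof.
split=> [|x _|c x y f _ _|i j x f _|i j x y f _ _].
- exact: (ffun_superspace (fun T : {set 'I_d} => odd #|T|) (mod_superspace actM)).
- exact: actP.
- exact: (ext_actr_linear X actM f c x y).
- exact: fin_par_act.
exact: (ext_act_br Xb actM F2).
Qed.

End KacIso.

(** * Derivatives of curves *)

Section CurveDerivative.
Variable R : realType.
Implicit Types (f : R -> R[i]) (t : R).

Definition is_cderive f t (d : R[i]) :=
  is_derive t 1 (fun s => complex.Re (f s)) (complex.Re d) /\
  is_derive t 1 (fun s => complex.Im (f s)) (complex.Im d).

Lemma is_cderive0 f t d : (forall s, f s = 0) -> is_cderive f t d -> d = 0.
Proof.
move=> f0 [[_ dRe] [_ dIm]].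
have E0 : (fun s => complex.Re (f s)) = cst 0 by apply/funext => s; rewrite f0.
have E1 : (fun s => complex.Im (f s)) = cst 0 by apply/funext => s; rewrite f0.
by move: dRe dIm; rewrite E0 E1 !derive_cst; case: d => a b /= <- <-.
Qed.

Lemma is_cderiveB f f' t d d' : is_cderive f t d -> is_cderive f' t d' ->
  is_cderive (fun s => f s - f' s) t (d - d').
Proof.
move=> [fRe fIm] [f'Re f'Im]; split.
  have -> : (fun s => complex.Re (f s - f' s)) =
      (fun s => complex.Re (f s)) - (fun s => complex.Re (f' s)).
    by apply/funext => s; rewrite raddfB.
  by rewrite raddfB; apply: is_deriveB.
have -> : (fun s => complex.Im (f s - f' s)) =
    (fun s => complex.Im (f s)) - (fun s => complex.Im (f' s)).
  by apply/funext => s; rewrite raddfB.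
by rewrite raddfB; apply: is_deriveB.
Qed.

Lemma is_cderiveN f t d : is_cderive f t d -> is_cderive (fun s => - f s) t (- d).
Proof.
move=> fd; have z0 : is_cderive (fun=> 0) t 0 by split; exact: is_derive_cst.
have := is_cderiveB z0 fd; rewrite sub0r.
by congr is_cderive; apply/funext => s; rewrite sub0r.
Qed.

Lemma is_cderiveZ (c : R[i]) f t d : is_cderive f t d ->
  is_cderive (fun s => f s * c) t (d * c).
Proof.
case: c => a b [fRe fIm].
have ReM (z : R[i]) : complex.Re (z * (a +i* b)) = a * complex.Re z - b * complex.Im z.
  by case: z => x y /=; rewrite [x * a]mulrC [y * b]mulrC.
have ImM (z : R[i]) : complex.Im (z * (a +i* b)) = b * complex.Re z + a * complex.Im z.
  by case: z => x y /=; rewrite [x * b]mulrC [y * a]mulrC.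
split.
  rewrite ReM; have -> : (fun s => complex.Re (f s * (a +i* b))) =
      (a *: (fun s => complex.Re (f s)) - b *: (fun s => complex.Im (f s))).
    by apply/funext => s; rewrite ReM.
  by apply: is_deriveB; apply: is_deriveZ.
rewrite ImM; have -> : (fun s => complex.Im (f s * (a +i* b))) =
    (b *: (fun s => complex.Re (f s)) + a *: (fun s => complex.Im (f s))).
  by apply/funext => s; rewrite ImM.
by apply: is_deriveD; apply: is_deriveZ.
Qed.

Variable V : lmodType R[i].

(* A value of [f] with a nonzero coordinate is itself a linear relation between
   the [e i], which eliminates one of them. *)
Lemma vanishing_curve_derive k (e : 'I_k -> V) (f : R -> 'I_k -> R[i]) t
    (f' : 'I_k -> R[i]) :
  (forall i, is_cderive (f^~ i) t (f' i)) ->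
  (forall s, \sum_i f s i *: e i = 0) -> \sum_i f' i *: e i = 0.
Proof.
elim: k e f f' => [|k IH] e f f' ff' f0; first by rewrite big_ord0.
have [[s0 [j fj0]]|allf0] := pselect (exists s j, f s j != 0); last first.
  rewrite big1 // => i _; rewrite (is_cderive0 _ (ff' i)) ?scale0r // => s.
  by apply/eqP/negPn/negP => fsi; apply: allf0; exists s, i.
pose c i := f s0 (lift j i) / f s0 j.
have ej : e j = - \sum_i c i *: e (lift j i).
  have := f0 s0; rewrite (bigD1_ord j) //= => /eqP; rewrite addr_eq0 => /eqP fe.
  rewrite -[LHS]scale1r -(mulVf fj0) -scalerA fe scalerN scaler_sumr; congr (- _).
  by apply: eq_bigr => i _; rewrite scalerA mulrC.
have elim_j (h : 'I_k.+1 -> R[i]) :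
    \sum_i h i *: e i = \sum_i (h (lift j i) - h j * c i) *: e (lift j i).
  rewrite (bigD1_ord j) //= ej scalerN scaler_sumr addrC -sumrB.
  by apply: eq_bigr => i _; rewrite scalerBl scalerA.
rewrite elim_j; apply: (IH _ (fun s i => f s (lift j i) - f s j * c i)) => [i|s].
  by apply: is_cderiveB => //; apply: is_cderiveZ.
by rewrite -elim_j.
Qed.

(** The spanning families need not be independent, so coordinates cannot be compared directly.
    Concatenating both families, with the second coordinates negated, presents the zero curve, to
    which [vanishing_curve_derive] applies. *)
Lemma curve_derive_unique (u : R -> V) t d d' :
  is_curve_derive u t d -> is_curve_derive u t d' -> d = d'.
Proof.
move=> [k [e [f [f' [uE ff' ->]]]]] [k2 [e2 [f2 [f2' [uE2 ff2' ->]]]]].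
pose sel (T : Type) (a : 'I_k -> T) (b : 'I_k2 -> T) (i : 'I_(k + k2)) :=
  match fintype.split i with inl x => a x | inr y => b y end.
have selE (a : 'I_k -> R[i]) (b : 'I_k2 -> R[i]) :
    \sum_i sel _ a (fun y => - b y) i *: sel _ e e2 i =
    \sum_i a i *: e i - \sum_i b i *: e2 i.
  rewrite big_split_ord -sumrN /=; congr (_ + _); apply: eq_bigr => i _.
    by rewrite /sel (unsplitK (inl i)).
  by rewrite /sel (unsplitK (inr i)) scaleNr.
apply/eqP; rewrite -subr_eq0 -selE; apply/eqP.
apply: (@vanishing_curve_derive _ _ (fun s => sel _ (f s) (fun y => - f2 s y)) t) => [i|s].
  rewrite /sel; case: (fintype.split i) => x; first exact: ff'.
  by apply: is_cderiveN; apply: ff2'.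
by rewrite selE -uE -uE2 subrr.
Qed.

Lemma curve_derive_affine (a b : V) t : curve_derive (fun s : R => a + s%:C *: b) t = b.
Proof.
have D : is_curve_derive (fun s : R => a + s%:C *: b) t b.
  (* The curve lies in the span of [a] and [b], with coordinates 1 and [s]. *)
  exists 2%N, (fun i => if i == 0 then a else b), (fun s i => if i == 0 then 1 else s%:C),
    (fun i => if i == 0 then 0 else 1); split=> [s|i|].
  - by rewrite !big_ord_recl big_ord0 /= scale1r addr0.
  - case: (i == 0) => /=; split; try exact: is_derive_cst.
    exact: is_derive_id.
  by rewrite !big_ord_recl big_ord0 /= scale0r add0r scale1r addr0.
apply: (curve_derive_unique _ D).
exact: (@xgetPex _ 0 [set d | is_curve_derive _ t d] (ex_intro _ b D)).
Qed.

End CurveDerivative.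

(** * The even part and the Jordan block *)

Section EvenPart.
Variables (F : fieldType) (g : lieSuper F).
Local Notation g0 := (par g false).

Lemma even_odd0 x : x \in g0 -> x \in par g true -> x = 0.
Proof. by move=> x0 x1; apply/eqP; rewrite -memv0 -(par_cap g) memv_cap x0. Qed.

Lemma mem_brv (U W : {vspace g}) x y : x \in U -> y \in W -> br x y \in brv U W.
Proof.
move=> xU yW; rewrite (coord_vbasis xU) -[br _ y]/(brr y _) linear_sum.
apply: memv_suml => i _; rewrite linearZ; apply: memvZ => /=.
rewrite /brr (coord_vbasis yW) linear_sum; apply: memv_suml => j _.
rewrite linearZ; apply: memvZ; apply: memv_span.
apply/allpairsP; exists ((vbasis U)`_i, (vbasis W)`_j).
by split; rewrite // mem_nth // size_tuple.
Qed.

(** Reductivity provides an ad-stable complement W' of the center in g_0. Central summands drop out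
    of brackets, so [g_0,g_0] is contained in W'. *)
Lemma lcenter_brv_cap : quasi_reductive g -> (lcenter g :&: brv g0 g0 = 0)%VS.
Proof.
case=> ss _.
have [|x w x0 /lcenterP[_ wc]|W' [W's WW' capW']] := ss (lcenter g).
- by apply/subvP => x /lcenterP[].
- by rewrite wc // mem0v.
apply/eqP; rewrite -subv0 -capW'; apply: capvS => //.
apply/span_subvP => _ /allpairsP[[x y] [/= xs ys ->]].
have x0 : x \in g0 by apply: vbasis_mem.
have : y \in g0 by apply: vbasis_mem.
rewrite -WW' => /memv_addP[z /lcenterP[_ zc] [w wW ->]].
by rewrite (linearD (br x)) /= zc // add0r; apply: W's.
Qed.

Lemma iota'_id x : quasi_reductive g -> x \in lcenter g -> iota' g x = x.
Proof. by move=> /lcenter_brv_cap; apply: daddv_pi_id. Qed.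

Lemma iota'_br x y : quasi_reductive g -> x \in g0 -> y \in g0 -> iota' g (br x y) = 0.
Proof.
move=> /lcenter_brv_cap cap x0 y0; have xy := mem_brv x0 y0.
have bid : daddv_pi (brv g0 g0) (lcenter g) (br x y) = br x y.
  by apply: daddv_pi_id; rewrite 1?capvC.
have := daddv_pi_add cap (subvP (addvSr _ _) _ xy).
by rewrite bid -[RHS]add0r => /addIr.
Qed.

(** An element of g_0 that is also odd is zero, so the parity cases of [is_module] collapse to the
    ungraded axioms. *)
Lemma is_module_even (V : lmodType F) (vp : bool -> set V) (act : g -> V -> V) :
  superspace vp -> (forall x, x \in g0 -> linear (act x)) ->
  (forall (a : F) x y v, x \in g0 -> y \in g0 ->
     act (a *: x + y) v = a *: act x v + act y v) ->
  (forall b x v, x \in g0 -> vp b v -> vp b (act x v)) ->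
  (forall x y v, x \in g0 -> y \in g0 ->
     act (br x y) v = act x (act y v) - act y (act x v)) ->
  is_module g0 vp act.
Proof.
move=> vpS lin linl par_act br_act.
have act0 v : act 0 v = 0.
  by have := linl (-1) 0 0 v (mem0v _) (mem0v _); rewrite scaler0 addr0 scaleN1r addNr.
have actr0 x : x \in g0 -> act x 0 = 0.
  by move=> x0; have := lin x x0 (-1) 0 0; rewrite scaler0 addr0 scaleN1r addNr.
split=> // [[] j x v x0 xi vj|i j x y v x0 y0 xi yj].
- by rewrite (even_odd0 x0 xi) act0; case: (vpS.1 (true (+) j)).
- exact: par_act.
case: i xi => [/(even_odd0 x0)->|xi]; first by rewrite br0l !act0 actr0 // scaler0 subr0.
case: j yj => [/(even_odd0 y0)->|yj]; last by rewrite scale1r br_act.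
by rewrite br0r !act0 actr0 // scaler0 subr0.
Qed.

End EvenPart.

Section JordanBlock.
Variables (F : fieldType) (L : lmodType F) (n : nat).
Local Notation LJ := {ffun 'I_n -> L}.

(** The operator 1 (x) N on L (x) C^n, with N the nilpotent Jordan block. *)
Definition jordan (m : LJ) : LJ := [ffun j => \sum_i (J_mx n (1 : F)) i j *: m i].

Lemma jordan_linear : linear jordan.
Proof.
move=> c u v; apply/ffunP => j; rewrite !ffunE scaler_sumr -big_split.
by apply: eq_bigr => i _; rewrite !ffunE scalerDr !scalerA mulrC.
Qed.
HB.instance Definition _ := GRing.isLinear.Build F LJ LJ *:%R
  jordan jordan_linear.

Lemma tensor_actE (a : L -> L) c (m : LJ) :
  tensor_act a (J_mx n c) m = [ffun j => a (m j)] + c *: jordan m.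
Proof.
apply/ffunP => j; rewrite !ffunE scaler_sumr; congr (_ + _).
apply: eq_bigr => i _; rewrite scalerA; congr (_ *: _).
by rewrite !mxE; case: ifP => _; rewrite ?mulr1 ?mulr0.
Qed.

Lemma jordan_nilE c (m : LJ) : tensor_act (fun=> 0) (J_mx n c) m = c *: jordan m.
Proof.
by rewrite tensor_actE -[RHS]add0r; congr (_ + _); apply/ffunP => j; rewrite !ffunE.
Qed.

Lemma jordan_par lp b (m : LJ) : (forall i, Defs.subspace (lp i)) ->
  tensor_par (F := F) (n := n) lp b m -> tensor_par (F := F) (n := n) lp b (jordan m).
Proof.
move=> lpS mb j; rewrite ffunE; apply: subspace_sum => // i.
exact: (subspaceZ _ (lpS b) (mb i)).
Qed.

Lemma tensor_par_superspace (lp : bool -> set L) :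
  superspace lp -> superspace (@tensor_par _ L n lp).
Proof.
move=> /(@ffun_superspace _ _ _ 'I_n (fun=> false)).
by congr superspace; apply/funext => b; apply/funext => f; rewrite /tensor_par /= addbF.
Qed.

End JordanBlock.

(** * The modules L (x) J_n(nu) over g_0 and over the even part of H *)

Section JordanModules.
Variables (F : fieldType) (g : typeI F) (L : lmodType F) (n : nat).
Variables (lp : bool -> set L) (nu : 'Hom(subvs_of (lcenter g), F^o)).
Local Notation LJ := {ffun 'I_n -> L}.
Local Notation lpn := (@tensor_par _ L n lp).

Definition nu_iota (x : g) : F := nu (vsproj (lcenter g) (iota' g x)).

Lemma nu_iota_linear : linear_for *%R nu_iota.
Proof. by move=> c x y; rewrite /nu_iota !linearP. Qed.

Lemma LJ_actE act x (m : LJ) :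
  LJ_act act nu x m = [ffun j => act x (m j)] + nu_iota x *: jordan m.
Proof. exact: tensor_actE. Qed.

(** The Jordan operator commutes with the action on L, and [nu_iota] vanishes on brackets by
    [iota'_br]; so the Jordan terms of the commutator cancel. *)
Lemma LJ_module act : quasi_reductive g -> is_module (par g false) lp act ->
  is_module (par g false) lpn (LJ_act (n := n) act nu).
Proof.
move=> qr actM; have lpS := (mod_superspace actM).1.
pose A x (m : LJ) : LJ := [ffun j => act x (m j)].
have E x m : LJ_act act nu x m = A x m + nu_iota x *: jordan m by apply: LJ_actE.
have Alin x c u v : x \in par g false -> A x (c *: u + v) = c *: A x u + A x v.
  by move=> x0; apply/ffunP => j; rewrite !ffunE (mod_linear actM).
have AD x u v : x \in par g false -> A x (u + v) = A x u + A x v.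
  by move=> x0; rewrite -[u]scale1r Alin // !scale1r.
have A0 x : x \in par g false -> A x 0 = 0.
  by move=> x0; have := Alin x (-1) 0 0 x0; rewrite scaler0 addr0 scaleN1r addNr.
have AZ x c u : x \in par g false -> A x (c *: u) = c *: A x u.
  by move=> x0; rewrite -[c *: u]addr0 Alin // A0 // addr0.
have AJ x m : x \in par g false -> A x (jordan m) = jordan (A x m).
  move=> x0; apply/ffunP => j; rewrite !ffunE.
  elim/big_rec2: _ => [|i u v _ <-]; last by rewrite (mod_linear actM) ?ffunE.
  by have := mod_linear actM x0 (-1) 0 0; rewrite scaler0 addr0 scaleN1r addNr.
apply: is_module_even => [|x x0 c u v|a x y m x0 y0|b x m x0 mb|x y m x0 y0].
- exact: tensor_par_superspace (mod_superspace actM).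
- by rewrite !E Alin // jordan_linear !scalerDr addrACA !scalerA mulrC.
- rewrite !E nu_iota_linear scalerDl -scalerA scalerDr addrACA; congr (_ + _).
  by apply/ffunP => j; rewrite !ffunE (mod_linear_l actM).
- rewrite E => j; rewrite ffunE ffunE.
  apply: (subspaceD (lpS _)); first exact: (mod_par actM x0 x0 (mb j)).
  by rewrite ffunE; apply: (subspaceZ _ (lpS _)); apply: (jordan_par lpS mb).
rewrite !E !AD // !AZ // !AJ // !(raddfD (@jordan _ _ _)) /= ![jordan (_ *: _)]linearZ /=.
rewrite /nu_iota iota'_br // !linear0 scale0r addr0.
have -> : A (br x y) m = A x (A y m) - A y (A x m).
  by apply/ffunP => j; rewrite !ffunE (mod_br actM _ x0 y0 x0 y0) scale1r.
have ac (p q r s u v : LJ) : p - q = p + r + (s + u) - (q + s + (r + u)).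
  by rewrite !opprD !addrA (ACl (1*5*2*7*3*6*4*8)) /= addrK addrK addrK.
rewrite !scalerDr !scalerA [nu _ * nu _]mulrC; exact: ac.
Qed.

Lemma HLJ_actE (u : Hg g) (m : LJ) : HLJ_act (n := n) nu u m = nu u.1.2 *: jordan m.
Proof. exact: jordan_nilE. Qed.

Lemma HLJ_module : superspace lp ->
  is_module (par (Hg g) false) lpn (HLJ_act (n := n) nu).
Proof.
move=> lpS; apply: is_module_even => [|x x0 c u v|a x y m x0 y0|b x m x0 mb|x y m x0 y0].
- exact: tensor_par_superspace.
- by rewrite !HLJ_actE jordan_linear scalerDr !scalerA mulrC.
- by rewrite !HLJ_actE linearP scalerDl scalerA.
- rewrite HLJ_actE => j; rewrite ffunE.
  by apply: (subspaceZ _ (lpS.1 _)); apply: (jordan_par lpS.1 mb).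
have -> : br x y = 0 by apply: (Hbr_even (i := false)).
by rewrite !HLJ_actE linear0 scale0r !linearZ /= !scalerA scalerN subrr.
Qed.

End JordanModules.

(** * Comparison with the superalgebra H *)

Section KacExtRep.
Variables (F : fieldType) (g : typeI F) (M : lmodType F).
Variables (mp : bool -> set M) (act : g -> M -> M).
Hypothesis actM : is_module (par g false) mp act.
Hypothesis F2 : 2%:R != 0 :> F.

Lemma kac_ext_repE x f : kac_ext_rep act x f = ext_act (vbasis (gm g)) act x f.
Proof.
have Xb := vbasisP (gm g).
apply: (can_inj (kac_mapK Xb actM F2)); rewrite (kac_map_act Xb actM F2).
(* Without a preimage [xget] would return its default 0; the explicit action supplies one, and
   injectivity of [kac_map] makes it the one chosen. *)
have [f' f'E] : exists f', kac_iso act f' = kac_rep x (kac_iso act f).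
  by exists (ext_act (vbasis (gm g)) act x f); apply: (kac_map_act Xb actM F2).
exact: (@xgetPex _ 0 [set f' | kac_iso act f' = kac_rep x (kac_iso act f)]
  (ex_intro _ f' f'E)).
Qed.

End KacExtRep.

(** * Transport of a basis of g_{-1} to H *)

Section HeisenbergBasis.
Variables (F : fieldType) (g : typeI F).

Definition Hinj (x : g) : Hg g := ((vsproj (gm g) x, 0, 0) : Hsort g).

Lemma Hinj_linear : linear Hinj.
Proof. by move=> c x y; rewrite /Hinj linearP HtripleZ HtripleD !scaler0 !addr0. Qed.
HB.instance Definition _ := GRing.isLinear.Build F g (Hg g) *:%R Hinj Hinj_linear.

(** Indexed by the dimension of g_{-1} in g, so that the explicit module over H lives on the space V
    itself. *)
Definition Hbasis : (\dim (gm g)).-tuple (Hg g) := map_tuple Hinj (vbasis (gm g)).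

Lemma HbasisE (i : 'I_(\dim (gm g))) : Hbasis`_i = Hinj (vbasis (gm g))`_i.
Proof. by rewrite (nth_map 0) // size_tuple. Qed.

Lemma Hbasis_of : basis_of (gm (Hg g)) Hbasis.
Proof.
have injE x : linfun Hinj x = Hinj x by rewrite lfunE.
have -> : gm (Hg g) = (linfun Hinj @: gm g)%VS.
  apply/vspaceP => -[[a h] b]; apply/idP/memv_imgP => [|[x xm ->]].
    rewrite [_ \in _]HgmE /= => /andP[/eqP-> /eqP->].
    by exists (vsval a); rewrite ?subvsP // injE /Hinj vsvalK.
  by rewrite injE [_ \in _]HgmE /= !eqxx.
have -> : Hbasis = [seq linfun Hinj x | x <- vbasis (gm g)] :> seq _.
  by apply: eq_map => x; rewrite injE.
apply: limg_basis_of (vbasisP _).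
apply/eqP; rewrite -subv0; apply/subvP => x; rewrite memv_cap memv_ker injE memv0.
by case/andP=> xm /eqP[/(congr1 vsval)]; rewrite vsprojK // => ->.
Qed.

Lemma coord_Hbasis i (a : subvs_of (gm g)) :
  coord Hbasis i ((a, 0, 0) : Hsort g) = coord (vbasis (gm g)) i (vsval a).
Proof.
have -> : ((a, 0, 0) : Hsort g) =
    \sum_(j < \dim (gm g)) coord (vbasis (gm g)) j (vsval a) *: Hbasis`_j.
  rewrite -[a in LHS]vsvalK -/(Hinj (vsval a)) {1}(coord_vbasis (subvsP a)) linear_sum.
  by apply: eq_bigr => j _; rewrite linearZ HbasisE.
by rewrite coord_sum_free // (basis_free Hbasis_of).
Qed.

End HeisenbergBasis.

Section Comparison.
Variables (F : fieldType) (g : typeI F) (L : lmodType F) (n : nat).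
Variables (act : g -> L -> L) (nu : 'Hom(subvs_of (lcenter g), F^o)).
Local Notation LJ := {ffun 'I_n -> L}.
Local Notation E := {ffun {set 'I_(\dim (gm g))} -> LJ}.
Local Notation X := (vbasis (gm g)).
Local Notation LJ_act c := (LJ_act (n := n) act (c *: nu)).
Implicit Types f : E.

Definition ext_jordan f : E := [ffun T => jordan (f T)].

(** This is rho'_t(x): the first term is the contribution of the g_0-component, the sum that of the
    g_1-component. *)
Definition ext_slope (x : g) f : E :=
  nu_iota nu (pi0 g x) *: ext_jordan f +
  \sum_(i < \dim (gm g)) nu_iota nu (pi0 g (br (pip g x) X`_i)) *: ext_jordan (annih i f).

(** The functional [nu] enters only through [ext_pw], and linearly; multiplications and derivations
    do not involve it. *)
Lemma ext_act_scale c x f :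
  ext_act X (LJ_act c) x f = ext_act X (LJ_act 0) x f + c *: ext_slope x f.
Proof.
have pwE y f' : ext_pw (LJ_act c) y f' =
    ext_pw (LJ_act 0) y f' + c *: (nu_iota nu (pi0 g y) *: ext_jordan f').
  apply/ffunP => T; rewrite !ffunE /kac_act !LJ_actE /nu_iota !scale_lfunE scale0r.
  by rewrite scale0r addr0 scalerA.
have gpE y : ext_gp X (LJ_act c) y f = ext_gp X (LJ_act 0) y f +
    c *: (\sum_(i < \dim (gm g)) nu_iota nu (pi0 g (br y X`_i)) *: ext_jordan (annih i f)).
  rewrite /ext_gp scaler_sumr -big_split; apply: eq_bigr => i _.
  by rewrite pwE addrAC.
rewrite /ext_act gpE /ext_ev pwE /ext_slope scalerDr.
have ac (p q r s u v : E) : p + (q + r + s) + (u + v) = p + (q + s) + u + (r + v).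
  by rewrite !addrA (ACl (1*2*4*5*3*6)).
by rewrite (pi0_id (pi0_mem x)); exact: ac.
Qed.

Lemma nu_iota0 : nu_iota nu 0 = 0. Proof. by rewrite /nu_iota !linear0. Qed.

Lemma ext_act_heisenberg (lp : bool -> set L) (u : Hg g) f :
  quasi_reductive g -> superspace lp ->
  ext_act (Hbasis g) (HLJ_act (n := n) nu) u f =
  ext_mul X (vsval u.1.1) f + ext_slope (vsval u.2) f + ext_slope (vsval u.1.2) f.
Proof.
move=> qr lpS; have HM := HLJ_module n nu lpS.
have Xb := Hbasis_of g.
pose um : Hg g := ((u.1.1, 0, 0) : Hsort g).
pose u0 : Hg g := ((0, u.1.2, 0) : Hsort g).
pose up : Hg g := ((0, 0, u.2) : Hsort g).
have uE : u = um + u0 + up.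
  by case: u @um @u0 @up => [[a h] b]; rewrite /= !HtripleD !addr0 !add0r.
have umP : um \in gm (Hg g) by rewrite [_ \in _]HgmE /= !eqxx.
have u0P : u0 \in par (Hg g) false by rewrite [_ \in _]HparE /= !eqxx.
have upP : up \in gp (Hg g) by rewrite [_ \in _]HgpE /= eqxx.
(* Even elements of H are central, so every derivation term vanishes, including those with
   coefficient 1/2. *)
have der0 v f' : v \in par (Hg g) false -> ext_der (Hbasis g) v f' = 0.
  move=> v0; apply: big1 => j _; have Xj := gm_odd (basis_gm Xb (ltn_ord j)).
  have -> : br v (Hbasis g)`_j = 0.
    by rewrite -[br _ _]/(Hbr v _) Hbr_sym; apply: Hbr_even Xj v0.
  exact: (linear0 (ext_mulr (Hbasis g) _)).
have pwE v f' : v \in par (Hg g) false ->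
    ext_pw (HLJ_act (n := n) nu) v f' = nu v.1.2 *: ext_jordan f'.
  by move=> v0; apply/ffunP => T; rewrite !ffunE /kac_act pi0_id // HLJ_actE.
rewrite {1}uE !(ext_actDl _ HM) (ext_act_gm _ HM) //.
rewrite (ext_act_g0 _ HM) // (ext_act_gp _ HM) //.
have -> : ext_mul (Hbasis g) um f = ext_mul X (vsval u.1.1) f.
  by apply: eq_bigr => i _; rewrite coord_Hbasis.
have -> : ext_ev (Hbasis g) (HLJ_act (n := n) nu) u0 f = ext_slope (vsval u.1.2) f.
  have h0 : vsval u.1.2 \in par g false by have /lcenterP[] := subvsP u.1.2.
  (* Reductivity enters here: [iota'] fixes the center. *)
  have nuh : nu_iota nu (vsval u.1.2) = nu u.1.2.
    by rewrite /nu_iota iota'_id ?subvsP // vsvalK.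
  rewrite /ext_ev /ext_slope der0 // pwE // pi0_id // nuh pip_g0 // big1 ?addr0 // => i _.
  by rewrite br0l linear0 nu_iota0 scale0r.
have -> : ext_gp (Hbasis g) (HLJ_act (n := n) nu) up f = ext_slope (vsval u.2) f.
  have bp := subvsP u.2.
  rewrite /ext_gp /ext_slope pi0_odd ?gp_odd // nu_iota0 scale0r add0r; apply: eq_bigr => i _.
  have Xi := basis_gm Xb (ltn_ord i).
  have ev : br up (Hbasis g)`_i \in par (Hg g) false.
    exact: (br_par (gp_odd upP) (gm_odd Xi)).
  have Xgi : X`_i \in gm g by apply: (basis_gm (vbasisP (gm g))).
  rewrite der0 // scaler0 addr0 pwE //; congr (_ *: _).
  rewrite HbasisE pip_gp // pi0_id ?(br_par (gp_odd bp) (gm_odd Xgi)) //.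
  (* The bracket in H is already [iota'] of the bracket in g; of its two summands only the one
     pairing [u.2] with X_i is nonzero. *)
  by rewrite /nu_iota /= vsprojK // linear0 add0r.
exact: addrAC.
Qed.

End Comparison.

Theorem lemmaA3p2 (R : realType) (g : typeI R[i]) (hh : {vspace g})
    (L : lmodType R[i]) (Lpar : bool -> set L) (act : g -> L -> L)
    (n : nat) (nu : 'Hom(subvs_of (lcenter g), R[i]^o)) :
  quasi_reductive g ->
  even_cartan hh -> diagonal_on hh (gm g) -> diagonal_on hh (gp g) ->
  is_module (par g false) Lpar act -> weight_finite hh act ->
  (0 < n)%N ->
  forall t : R,
    let V := extmod g {ffun 'I_n -> L} in
    let Vpar : bool -> set V := ext_par (@tensor_par _ L n Lpar) in
    let KH := kac (HLJ_act (L := L) (n := n) nu) in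
    let KHpar : bool -> set KH := @kac_par _ _ _ _ (@tensor_par _ L n Lpar) in
    is_module (g := Hg g) fullv Vpar (phi (n := n) act nu t) /\
    exists Theta : V -> KH,
      [/\ linear Theta, bijective Theta,
          forall b v, Vpar b v <-> KHpar b (Theta v)
        & forall (u : Hg g) v, Theta (phi act nu t u v) = kac_rep u (Theta v)].
Proof.
move=> qr _ _ _ actM _ _ t V Vpar KH KHpar.
have F2 : 2%:R != 0 :> R[i] by rewrite pnatr_eq0.
have lpS := mod_superspace actM.
have HM := HLJ_module n nu lpS.
have rhoE s x v : rho (n := n) act nu s x v =
    ext_act (vbasis (gm g)) (LJ_act (n := n) act (s%:C *: nu)) x v.
  exact: kac_ext_repE (LJ_module n _ qr actM) F2 x v.
(* The curve is affine in the parameter, so its derivative is the slope at every [t]. *)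
have drhoE x v : drho (n := n) act nu t x v = ext_slope nu x v.
  rewrite /drho; have -> : (fun s => rho act nu s x v) = (fun s : R =>
      ext_act (vbasis (gm g)) (LJ_act (n := n) act (0 *: nu)) x v + s%:C *: ext_slope nu x v).
    apply/funext => s; rewrite rhoE; exact: ext_act_scale.
  exact: curve_derive_affine.
(* [phi] coincides with the explicit action of H on V, so the general results on that action apply
   with H in place of g. *)
have phiE : phi (n := n) act nu t = ext_act (Hbasis g) (HLJ_act (n := n) nu).
  apply/funext => u; apply/funext => v.
  rewrite (ext_act_heisenberg nu u v qr lpS) /phi !drhoE rhoE; congr (_ + _ + _).
  by rewrite (ext_act_gm _ (LJ_module n _ qr actM)) // subvsP.
rewrite phiE; split; first exact: (ext_act_module (Hbasis_of g) HM F2).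
exists (kac_map (Hbasis g) (HLJ_act (n := n) nu)); split.
- exact: kac_map_linear.
- exact: (kac_map_bij (Hbasis_of g) HM F2).
- by move=> b v; apply: (fin_parP (Hbasis_of g) HM F2).
by move=> u v; apply: (kac_map_act (Hbasis_of g) HM F2).
Qed.
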